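(* Consider the $N$-agent game and the zeroth-order asynchronous algorithm described in the context. Assume: (1) (Partial asynchronism) each agent $i$ updates at least once in every time interval of length $B$, i.e. $\mathbb{T}^i\cap[t,t+B)\neq\emptyset$ for all integers $t\ge 1$ and all $i=1,\dots,N$, where $B\ge 1$ is an integer. (2) (Quasidominance) for each $i$, $C_i(x_i,x_{-i})$ is $\mu_i$-strongly convex in $x_i\in\mathcal{X}_i$ for every $x_{-i}$ (with $\mu_i>0$), and for each $j=1,\dots,N$ (including $j=i$) the map $x\mapsto\nabla_i C_i(x)$ is $L_{ij}$-Lipschitz in $x_j$ (the other coordinates being fixed); moreover there is a vector $r=(r_1,\dots,r_N)$ with all $r_i>0$ such that $r_i\mu_i>\sum_{j\ne i}r_jL_{ij}$ for all $i=1,\dots,N$. (3) (Bounded gradients) $\|\nabla_i C_i(x)\|\le U$ for all $x\in\mathcal{X}$ and all $i=1,\dots,N$. (4) (Bounded costs) $|C_i(x)|\le U_c$ for all $x\in\mathcal{X}$ and all $i=1,\dots,N$. Let $\varepsilon:=\min_i\big\{\mu_i-\frac{1}{r_i}\sum_{j\ne i}r_jL_{ij}\big\}>0$ and run the algorithm with $\delta=\frac{B}{T^{1/3}}$ and $\eta=\frac{B\ln(T/B)}{\varepsilon T}$. Then $$\max_i\mathbb{E}\|x_{i,T}-x_i^*\|^2=\mathcal{O}\Big(\frac{B^2\ln(T/B)}{T^{1/3}}\Big),$$ where $x^*=(x_1^*,\dots,x_N^* )$ is the unique Nash equilibrium. That is, there is a constant $c>0$, depending only on the game data ($N$, $d$,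 $R$, $D$, $U$, $U_c$, the $\mu_i$, $L_{ij}$ and $r_i$) and not on $T$, $B$, the update sets $\mathbb{T}^i$ or the initial values, such that for all integers $B\ge 1$ and $T\ge 2B$ with $\delta=B/T^{1/3}<R$ and all update sets satisfying (1), $\max_i\mathbb{E}\|x_{i,T}-x_i^*\|^2\le c\,\frac{B^2\ln(T/B)}{T^{1/3}}$.
   Context: Game. There are $N$ agents. Agent $i$ chooses an action $x_i$ in a closed convex set $\mathcal{X}_i\subseteq\mathbb{R}^d$; each $\mathcal{X}_i$ contains the ball of radius $R>0$ centered at the origin and has diameter at most $D>0$. Put $\mathcal{X}=\prod_{i=1}^N\mathcal{X}_i$. Agent $i$ has a (Borel measurable) real-valued cost function $C_i(x)=C_i(x_i,x_{-i})$ on $\mathcal{X}$, differentiable in $x_i$, where $x_{-i}$ denotes the actions of all agents other than $i$; $\nabla_iC_i$ denotes the gradient of $C_i$ with respect to $x_i$. A Nash equilibrium is a point $x^*\in\mathcal{X}$ with $C_i(x_i^*,x_{-i}^* )\le C_i(x_i,x_{-i}^* )$ for all $x_i\in\mathcal{X}_i$ and all $i$; under the quasidominance assumption it exists and is unique. Asynchronous updates. For each $i$, $\mathbb{T}^i\subseteq\{1,2,\dots\}$ is a given (deterministic) set of time steps; $t\in\mathbb{T}^i$ means agent $i$ changes its action between time $t$ and time $t+1$. Zeroth-order asynchronous algorithm. Parameters: step size $\eta>0$ and perturbation size $\delta\in(0,R)$. Let $\mathcal{X}_i^\delta=\{x_i\in\mathcal{X}_i : \frac{1}{1-\delta/R}x_i\in\mathcal{X}_i\}$.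 Initial values are deterministic points $x_{i,1}\in\mathcal{X}_i^\delta$ and $\hat{x}_{i,0}\in\mathcal{X}_i$. The random vectors $u_{i,t}$ ($i=1,\dots,N$, $t\in\mathbb{T}^i$) are independent and uniformly distributed on the unit sphere of $\mathbb{R}^d$. At each time $t=1,2,\dots$, agent $i$ plays $$\hat{x}_{i,t}=\begin{cases}x_{i,t}+\delta u_{i,t}, & t\in\mathbb{T}^i,\\ \hat{x}_{i,t-1}, & \text{otherwise},\end{cases}$$ and then, with $\hat{x}_t=(\hat{x}_{1,t},\dots,\hat{x}_{N,t})$ and $g_{i,t}=\frac{d}{\delta}C_i(\hat{x}_t)u_{i,t}$, sets $$x_{i,t+1}=\begin{cases}\mathcal{P}_{\mathcal{X}_i^\delta}\big(x_{i,t}-\eta g_{i,t}\big), & t\in\mathbb{T}^i,\\ x_{i,t}, & \text{otherwise},\end{cases}$$ where $\mathcal{P}_{\mathcal{X}_i^\delta}$ is the Euclidean projection onto $\mathcal{X}_i^\delta$. The expectation $\mathbb{E}$ is over all the $u_{i,t}$. *)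

(* Defs.v *)
From HB Require Import structures.
From mathcomp Require Import all_boot all_order all_algebra.
From mathcomp Require Import all_classical all_reals all_analysis.

Set Implicit Arguments.
Unset Strict Implicit.
Unset Printing Implicit Defensive.

Import Order.TTheory GRing.Theory Num.Theory.
Import numFieldNormedType.Exports.

Local Open Scope classical_set_scope.
Local Open Scope ring_scope.

(* Points of R^d are row vectors.  An action profile of N agents is an
   N x d matrix whose i-th row is the action of agent i. *)

Section Euclidean.
Context {R : realType} {d : nat}.
Implicit Types (u v x y p g : 'rV[R]_d) (A : set 'rV[R]_d) (f : 'rV[R]_d -> R).

Definition dotv u v : R := \sum_(k < d) u 0 k * v 0 k.

(* The norm `|u| of the library is the sup norm, hence this definition. *)
Definition enorm u : R := Num.sqrt (dotv u u).

Definition is_proj A y p : Prop :=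
  A p /\ forall z, A z -> enorm (y - p) <= enorm (y - z).

(* When A is nonempty, closed and convex, exactly one p satisfies is_proj A y p. *)
Definition proj A y : 'rV[R]_d := xget 0 [set p | is_proj A y p].

Definition strongly_convex (m : R) A f : Prop :=
  forall x y (s : R), A x -> A y -> 0 <= s <= 1 ->
    f (s *: x + (1 - s) *: y) <=
      s * f x + (1 - s) * f y - m / 2 * s * (1 - s) * enorm (x - y) ^+ 2.

(* Frechet gradient at x of f relative to A, so that only the values of f on A
   matter; it is unique when A is convex with nonempty interior. *)
Definition is_gradient A f x g : Prop :=
  forall e : R, 0 < e -> exists2 a : R, 0 < a &
    forall y, A y -> enorm (y - x) <= a ->
      `|f y - f x - dotv g (y - x)| <= e * enorm (y - x).

Definition gradient A f x : 'rV[R]_d := xget 0 [set g | is_gradient A f x g].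

End Euclidean.

Section Game.
Context {R : realType} {N d : nat}.
Implicit Types (X : 'I_N -> set 'rV[R]_d) (C : 'I_N -> 'M[R]_(N, d) -> R).
Implicit Types (x : 'M[R]_(N, d)) (i : 'I_N).

Definition profiles X : set 'M[R]_(N, d) := [set x | forall i, X i (row i x)].

(* (v, x_{-i}) *)
Definition deviate x i (v : 'rV[R]_d) : 'M[R]_(N, d) :=
  \matrix_(j < N) (if j == i then v else row j x).

Definition own_cost C i x : 'rV[R]_d -> R := fun v => C i (deviate x i v).

Definition differentiable_own X C i x : Prop :=
  exists g, is_gradient (X i) (own_cost C i x) (row i x) g.

Definition own_gradient X C i x : 'rV[R]_d :=
  gradient (X i) (own_cost C i x) (row i x).

Definition is_nash X C x : Prop :=
  profiles X x /\ forall i v, X i v -> C i x <= C i (deviate x i v).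

Definition shrink (A : set 'rV[R]_d) (rho delta : R) : set 'rV[R]_d :=
  [set v | A v /\ A ((1 - delta / rho)^-1 *: v)].

(* The infimum is over a finite set, so it is a minimum as soon as 0 < N. *)
Definition dominance_margin (mu r : 'I_N -> R) (L : 'I_N -> 'I_N -> R) : R :=
  inf [set mu i - (r i)^-1 * \sum_(j < N | j != i) r j * L i j | i in [set: 'I_N]].

(* One realization of the algorithm: Tup i is the set of update times of agent i,
   u i t the perturbation direction, x t = (x_{i,t})_i for t >= 1 and
   xh t the profile actually played at time t, with xh 0 the initial value. *)
Definition zo_run X C (rho eta delta : R) (Tup : 'I_N -> set nat)
    (x1 xh0 : 'M[R]_(N, d)) (u : 'I_N -> nat -> 'rV[R]_d)
    (x xh : nat -> 'M[R]_(N, d)) : Prop :=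
  [/\ x 1%N = x1,
      xh 0%N = xh0,
      (forall t i, (1 <= t)%N ->
        row i (xh t) = if t \in Tup i then row i (x t) + delta *: u i t
                       else row i (xh t.-1))
    & (forall t i, (1 <= t)%N ->
        row i (x t.+1) =
          if t \in Tup i then
            proj (shrink (X i) rho delta)
              (row i (x t) - eta *: ((d%:R / delta * C i (xh t)) *: u i t))
          else row i (x t))].

End Game.

(* Matrices with the Borel sigma-algebra. *)
Definition borel_mx (R : realType) (m n : nat) :=
  g_sigma_algebraType (@open 'M[R]_(m, n)).

Section Random.
Context {R : realType} {dO : measure_display} {Om : measurableType dO}.
Variable P : probability Om R.

Definition mutually_independent (I : eqType) (K : set I) {dV : measure_display}
    (S : measurableType dV) (V : I -> Om -> S) : Prop :=
  forall (s : seq I) (A : I -> set S),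
    uniq s -> (forall k, k \in s -> K k) -> (forall k, measurable (A k)) ->
    (P (\bigcap_(k in [set` s]) (V k @^-1` A k))
      = \prod_(k <- s) P (V k @^-1` A k))%E.

(* The uniform distribution on the unit sphere is the Borel probability on it
   that is invariant under the orthogonal group O(d). *)
Definition uniform_on_sphere {d : nat} (V : Om -> 'rV[R]_d) : Prop :=
  [/\ measurable_fun setT (V : Om -> borel_mx R 1 d),
      (forall w, enorm (V w) = 1)
    & forall Q : 'M[R]_d, Q *m Q^T = 1%:M ->
      forall A : set (borel_mx R 1 d), measurable A ->
        P ((fun w => V w *m Q) @^-1` A) = P (V @^-1` A)].

End Random.

(* Main.v *)
(* On a smooth convex cost the one-point estimate (n / delta) C(x + delta u) u has the
   mean of a gradient step up to O(delta): convexity and the Lipschitz gradient give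
   C(x + delta u) = C(x) + delta <grad C(x), u> + O(delta^2), while invariance of u under
   O(n) gives E[u] = 0 and E[u_k u_l] = [k = l] / n, so no divergence theorem is needed.
   Conditioning on everything but u_{i,t} is replaced by a pi-lambda argument: the profile
   seen by the estimate is measurable for the sigma-algebra generated by the other
   directions.  Weighting the mean square distances to (1 - delta / rho) x* by r_i^-2,
   quasidominance and AM-GM turn an update of agent i at time t >= B into a contraction
   by 1 - 2 eta eps of the maximum over the agents, up to an error of order
   eta (delta + eta / delta + eta / delta^2).  Every agent updates in each window of length
   B, so the maximum contracts about T / B times before time T. *)
Require Import Defs.
From HB Require Import structures.
From mathcomp Require Import all_boot all_order all_algebra.
From mathcomp Require Import all_classical all_reals all_analysis.
From mathcomp Require Import measurable_realfun.
From mathcomp Require Import fingroup perm.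
From mathcomp Require Import ring lra zify.
Import Order.TTheory GRing.Theory Num.Theory.
Set Implicit Arguments.
Unset Strict Implicit.
Unset Printing Implicit Defensive.
Import numFieldNormedType.Exports.
Local Open Scope classical_set_scope.
Local Open Scope ring_scope.

(* [mathcomp_extra.proj] shadows the projection of [Defs]. *)
Local Notation proj := Defs.proj.

(** * Euclidean geometry and projections *)

(** The independence argument applies to quantities measurable for the other directions, whereas
    [own_gradient] is picked by a choice operator. Difference quotients of the costs replace it:
    they are measurable because the costs are, and each coordinate is off by at most
    [L i i * delta], the order of the other errors. An idle agent goes on playing its last perturbed
    action, so the gradients are taken at profiles that lag behind the iterates by at most [delta]
    plus one step, but only once every agent has updated. Hence the estimates start at time [B],
    where the squared distances are merely bounded by [D ^+ 2]. Errors do not accumulate: the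
    recursion is relative to a level [W], a constant times the rate, chosen so that the gain
    [2 * eta * eps * W] of a contraction pays for the error of one update. It needs a nonnegative
    contraction factor; when [eta] is too large for this, the diameter alone gives the rate. Up to
    constants, [delta], [eta / delta^2] and the contracted initial distance, of order at most
    [(B/T)^(2/3)], are all below the rate. *)

Section EuclideanTheory.
Context {R : realType} {n : nat}.
Implicit Types (u v w x y p g : 'rV[R]_n) (a : R).

Lemma dotvC u v : dotv u v = dotv v u.
Proof. by apply: eq_bigr => k _; rewrite mulrC. Qed.

Lemma dotvDl u v w : dotv (u + v) w = dotv u w + dotv v w.
Proof. by rewrite -big_split; apply: eq_bigr => k _; rewrite /= mxE mulrDl. Qed.

Lemma dotvZl a u v : dotv (a *: u) v = a * dotv u v.
Proof. by rewrite mulr_sumr; apply: eq_bigr => k _; rewrite mxE mulrA. Qed.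

Lemma dotvNl u v : dotv (- u) v = - dotv u v.
Proof. by rewrite -scaleN1r dotvZl mulN1r. Qed.

Lemma dotvBl u v w : dotv (u - v) w = dotv u w - dotv v w.
Proof. by rewrite dotvDl dotvNl. Qed.

Lemma dotvDr u v w : dotv u (v + w) = dotv u v + dotv u w.
Proof. by rewrite !(dotvC u) dotvDl. Qed.

Lemma dotvZr a u v : dotv u (a *: v) = a * dotv u v.
Proof. by rewrite !(dotvC u) dotvZl. Qed.

Lemma dotvNr u v : dotv u (- v) = - dotv u v.
Proof. by rewrite !(dotvC u) dotvNl. Qed.

Lemma dotvBr u v w : dotv u (v - w) = dotv u v - dotv u w.
Proof. by rewrite !(dotvC u) dotvBl. Qed.

Lemma dotv0l u : dotv 0 u = 0.
Proof. by rewrite -[X in dotv X](scale0r u) dotvZl mul0r. Qed.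

Lemma dotv_ge0 u : 0 <= dotv u u.
Proof. by apply: sumr_ge0 => k _; rewrite -expr2 sqr_ge0. Qed.

Lemma enorm_ge0 u : 0 <= enorm u.
Proof. exact: sqrtr_ge0. Qed.

Lemma enorm_sq u : enorm u ^+ 2 = dotv u u.
Proof. by rewrite sqr_sqrtr // dotv_ge0. Qed.

Lemma enorm0 : enorm (0 : 'rV[R]_n) = 0.
Proof. by rewrite /enorm /dotv big1 ?sqrtr0 // => k _; rewrite mxE mul0r. Qed.

Lemma enorm_eq0 u : enorm u = 0 -> u = 0.
Proof.
move=> u0; have /eqP : dotv u u = 0 by rewrite -enorm_sq u0 expr0n.
rewrite psumr_eq0 => [/allP h|k _]; last by rewrite -expr2 sqr_ge0.
apply/rowP => k; have := h k; rewrite mem_index_enum mulf_eq0 orbb mxE.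
by move=> /(_ isT) /eqP.
Qed.

Lemma enormZ a u : enorm (a *: u) = `|a| * enorm u.
Proof.
by rewrite /enorm dotvZl dotvZr mulrA -expr2 sqrtrM ?sqr_ge0 // sqrtr_sqr.
Qed.

Lemma enormN u : enorm (- u) = enorm u.
Proof. by rewrite -scaleN1r enormZ normrN normr1 mul1r. Qed.

Lemma enormBC u v : enorm (u - v) = enorm (v - u).
Proof. by rewrite -enormN opprB. Qed.

(** Cauchy-Schwarz: for nonzero vectors, expand the squared norm of [enorm v *: u - enorm u *: v]
    and divide by the product of the norms. *)
Lemma dotv_le u v : dotv u v <= enorm u * enorm v.
Proof.
have [u0|u0] := eqVneq (enorm u) 0.
  by rewrite (enorm_eq0 u0) dotv0l enorm0 mul0r.
have [v0|v0] := eqVneq (enorm v) 0.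
  by rewrite (enorm_eq0 v0) dotvC dotv0l enorm0 mulr0.
have up : 0 < enorm u by rewrite lt_neqAle eq_sym u0 enorm_ge0.
have vp : 0 < enorm v by rewrite lt_neqAle eq_sym v0 enorm_ge0.
have := dotv_ge0 (enorm v *: u - enorm u *: v).
rewrite !(dotvBl, dotvBr, dotvZl, dotvZr) -!enorm_sq (dotvC v u).
set a := enorm u in up *; set b := enorm v in vp *; set c := dotv u v.
have ab : 0 < a * b by apply: mulr_gt0.
by move=> h; rewrite -subr_ge0 -(pmulr_rge0 _ ab); nra.
Qed.

Lemma normr_dotv_le u v : `|dotv u v| <= enorm u * enorm v.
Proof.
rewrite ler_norml dotv_le andbT lerNl -dotvNl.
by rewrite -(enormN u) dotv_le.
Qed.

Lemma enorm_sqD u v : enorm (u + v) ^+ 2 = enorm u ^+ 2 + 2 * dotv u v + enorm v ^+ 2.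
Proof. by rewrite !enorm_sq dotvDl !dotvDr (dotvC v u); ring. Qed.

Lemma enorm_sqB u v : enorm (u - v) ^+ 2 = enorm u ^+ 2 - 2 * dotv u v + enorm v ^+ 2.
Proof. by rewrite enorm_sqD dotvNr enormN; ring. Qed.

Lemma ler_enormD u v : enorm (u + v) <= enorm u + enorm v.
Proof.
rewrite -(@ler_pXn2r _ 2) ?nnegrE ?addr_ge0 ?enorm_ge0 //.
by rewrite enorm_sqD; have := dotv_le u v; nra.
Qed.

Lemma ler_enormB u v : enorm (u - v) <= enorm u + enorm v.
Proof. by rewrite (le_trans (ler_enormD _ _)) // enormN. Qed.

Lemma enorm_triangle w u v : enorm (u - v) <= enorm (u - w) + enorm (w - v).
Proof. by rewrite -[u - v](subrKA w) ler_enormD. Qed.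

Lemma coord_le_enorm u k : `|u 0 k| <= enorm u.
Proof.
rewrite -(@ler_pXn2r _ 2) ?nnegrE ?normr_ge0 ?enorm_ge0 // enorm_sq.
rewrite real_normK ?num_real // expr2 /dotv (bigD1 k) //= lerDl.
by apply: sumr_ge0 => j _; rewrite -expr2 sqr_ge0.
Qed.

Lemma enorm_le_sum u : enorm u <= \sum_k `|u 0 k|.
Proof.
have s0 (P : pred 'I_n) : 0 <= \sum_(k | P k) `|u 0 k| by apply: sumr_ge0.
rewrite -(@ler_pXn2r _ 2) ?nnegrE ?enorm_ge0 //.
rewrite enorm_sq /dotv expr2 mulr_suml; apply: ler_sum => k _.
rewrite -expr2 -real_normK ?num_real // expr2 ler_wpM2l //.
by rewrite (bigD1 k) //= lerDl.
Qed.

Lemma coord_le_norm (u : 'rV[R]_n) k : `|u 0 k| <= `|u|.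
Proof.
rewrite [leRHS]/Num.Def.normr /= mx_normrE.
by apply/bigmax_geP; right => /=; exists (ord0, k).
Qed.

Lemma norm_le_enorm u : `|u| <= enorm u.
Proof.
rewrite [leLHS]/Num.Def.normr /= mx_normrE; apply/bigmax_leP; split=> [|[i k] _] /=.
  exact: enorm_ge0.
by rewrite (ord1 i) coord_le_enorm.
Qed.

Lemma enorm_le_norm u : enorm u <= n%:R * `|u|.
Proof.
apply: (le_trans (enorm_le_sum u)).
apply: (@le_trans _ _ (\sum_(k < n) `|u|)).
  by apply: ler_sum => k _; exact: coord_le_norm.
by rewrite sumr_const card_ord mulr_natl.
Qed.

Lemma lipschitz_continuous (f : 'rV[R]_n -> R) (K : R) :
  (forall u v, `|f u - f v| <= K * enorm (u - v)) -> continuous f.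
Proof.
move=> fK u; apply: (@cvgrPdist_lt _ _ _ (nbhs u) _ f (f u)).2 => e e0.
(* The library topology is that of the sup norm, whence the factor [n]; the added ones keep [M]
   positive for every [K] and [n]. *)
pose M := (`|K| + 1) * (n%:R + 1).
have M0 : 0 < M by rewrite mulr_gt0 // ltr_pwDr.
have eM : 0 < e / M by rewrite divr_gt0.
near=> v.
have uv : `|u - v| < e / M.
  by near: v; apply/nbhs_ballP; exists (e / M) => //= v; rewrite -ball_normE.
apply: le_lt_trans (fK _ _) _.
apply: (@le_lt_trans _ _ (M * `|u - v|)); last by rewrite mulrC -ltr_pdivlMr.
apply: (@le_trans _ _ ((`|K| + 1) * enorm (u - v))).
  by rewrite ler_wpM2r ?enorm_ge0 // (le_trans (ler_norm K)) // lerDl.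
rewrite /M -mulrA ler_wpM2l ?addr_ge0 // (le_trans (enorm_le_norm _)) //.
by rewrite ler_wpM2r // lerDl.
Unshelve. all: by end_near.
Qed.

Lemma enorm_lipschitz u v : `|enorm u - enorm v| <= enorm (u - v).
Proof.
rewrite ler_norml; apply/andP; split.
  by have := ler_enormB u (u - v); rewrite subKr; lra.
by have := ler_enormD (u - v) v; rewrite subrK; lra.
Qed.

Lemma convex_setP (A : set 'rV[R]_n) (s : R) x y : convex_set A ->
  A x -> A y -> 0 <= s <= 1 -> A (s *: x + (1 - s) *: y).
Proof.
move=> cA Ax Ay s01.
have := cA x y (Itv01 (andP s01).1 (andP s01).2) (mem_set Ax) (mem_set Ay).
by move/set_mem.
Qed.

Section Projection.
Variables (A : set 'rV[R]_n).
Hypotheses (A0 : A 0) (clA : closed A) (cvA : convex_set A).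

(** Since 0 lies in [A], a nearest point can be sought in the part of [A] within distance [enorm y]
    of [y], which is compact and nonempty. *)
Lemma is_proj_ex y : exists p, is_proj A y p.
Proof.
pose K := A `&` [set z | enorm (y - z) <= enorm y].
have cd : continuous (fun z : 'rV[R]_n => enorm (y - z)).
  apply: (@lipschitz_continuous _ 1) => u v; rewrite mul1r.
  by rewrite (le_trans (enorm_lipschitz _ _)) // addrC opprB subrKA enormBC.
have cK : compact K.
  apply: bounded_closed_compact.
    exists (2 * enorm y); split; first exact: num_real.
    move=> M yM z [_ /= zy]; apply: (le_trans (norm_le_enorm z)).
    apply: le_trans (ltW yM); have := ler_enormB y (y - z); rewrite subKr; lra.
  apply: closedI => //.
  exact (preimage_closed (D := [set a | a <= enorm y]) (fun z _ => cd z) (@closed_le _ _)).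
have K0 : K !=set0 by exists 0; split => //=; rewrite subr0.
have [p pK minp] := EVT_min_rV K0 cK (continuous_subspaceT cd).
have [Ap py] := set_mem pK.
exists p; split=> // z Az.
have [zy|zy] := leP (enorm (y - z)) (enorm y).
  by apply: minp; apply: mem_set.
by apply: le_trans (ltW zy).
Qed.

Lemma projP y : is_proj A y (proj A y).
Proof. by have [p yp] := is_proj_ex y; apply: (@xgetPex _ 0 [set p | is_proj A y p]); exists p. Qed.

Lemma proj_in y : A (proj A y).
Proof. by have [] := projP y. Qed.

Lemma proj_variational y z : A z -> dotv (y - proj A y) (z - proj A y) <= 0.
Proof.
move=> Az; have [Ap minp] := projP y; set p := proj A y in Ap minp *.
rewrite leNgt; apply/negP => h.
set c := dotv _ _ in h; set w := z - p in c h; set b := enorm w ^+ 2.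
have b0 : 0 <= b by rewrite sqr_ge0.
(* Moving from [p] by [s *: w] changes the squared distance to [y] by [s * (s * b - 2 * c)]. This
   [s] stays in [0, 1] and satisfies [s * b < c], so the distance would decrease. *)
pose s := c / (c + b).
have cb : 0 < c + b by rewrite ltr_pwDl.
have s01 : 0 <= s <= 1.
  by rewrite /s divr_ge0 ?(ltW h) ?(ltW cb) //= ler_pdivrMr // mul1r lerDl.
have := minp _ (convex_setP cvA Az Ap s01).
rewrite -(@ler_pXn2r _ 2) ?nnegrE ?enorm_ge0 //.
have -> : y - (s *: z + (1 - s) *: p) = (y - p) - s *: w.
  by apply/rowP => k; rewrite !mxE; ring.
rewrite (enorm_sqB (y - p)) dotvZr -/c enormZ exprMn -/b real_normK ?num_real //.
have sE : s * (c + b) = c by rewrite /s divfK // gt_eqF.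
have s0 : 0 < s by rewrite /s divr_gt0.
have : s * b < 2 * c by nra.
rewrite -subr_gt0 -(pmulr_rgt0 _ s0).
set q := enorm (y - p) ^+ 2; nra.
Qed.

(** Adding the variational inequalities of the two projections, each tested at the other one, bounds
    the squared distance between them by [dotv (y - z) (p - q)]. *)
Lemma proj_nonexpansive y z : enorm (proj A y - proj A z) <= enorm (y - z).
Proof.
have h1 := proj_variational y (proj_in z).
have h2 := proj_variational z (proj_in y).
set p := proj A y in h1 h2 *; set q := proj A z in h1 h2 *.
have h : enorm (p - q) ^+ 2 <= dotv (y - z) (p - q).
  rewrite -subr_ge0.
  have -> : dotv (y - z) (p - q) - enorm (p - q) ^+ 2 =
     - dotv (y - p) (q - p) - dotv (z - q) (p - q).
    rewrite enorm_sq !(dotvBl, dotvBr) (dotvC q p); ring.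
  lra.
have h3 := le_trans h (dotv_le _ _).
have [e0|e0] := eqVneq (enorm (p - q)) 0; first by rewrite e0 enorm_ge0.
have pq : 0 < enorm (p - q) by rewrite lt_neqAle eq_sym e0 enorm_ge0.
by rewrite -(ler_pM2r pq) -expr2.
Qed.

Lemma proj_id z : A z -> proj A z = z.
Proof.
move=> Az; have [Ap minp] := projP z.
have := minp z Az; rewrite subrr enorm0 => h.
have /eqP : z - proj A z = 0.
  by apply: enorm_eq0; apply/eqP; rewrite eq_le h enorm_ge0.
by rewrite subr_eq0 eq_sym => /eqP.
Qed.

Lemma proj_le y z : A z -> enorm (proj A y - z) <= enorm (y - z).
Proof. by move=> Az; rewrite -{1}(proj_id Az) proj_nonexpansive. Qed.

End Projection.

End EuclideanTheory.

(** * Gradients of the game *)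

Section GradientTheory.
Context {R : realType} {n : nat}.
Implicit Types (u v w x y p g : 'rV[R]_n) (A : set 'rV[R]_n) (f : 'rV[R]_n -> R).

(** Stands for the limit at 0 along the segment from [x] to [y]: one [s] makes both the step and the
    relative error at most [c]. Convexity keeps the segment inside [A], where the gradient condition
    applies; the [+ 1] in [b + 1] covers [x = y]. *)
Lemma is_gradient_segment A f x y g : convex_set A -> A x -> A y ->
  is_gradient A f x g -> forall c : R, 0 < c -> exists2 s : R, 0 < s <= c &
    s <= 1 /\
    `|f (s *: y + (1 - s) *: x) - f x - s * dotv g (y - x)| <= c * s.
Proof.
move=> cA Ax Ay gx c c0.
set b := enorm (y - x); have b0 : 0 <= b by exact: enorm_ge0.
have b1 : 0 < b + 1 by rewrite ltr_pwDr.
have [a a0 ga] := gx _ (divr_gt0 c0 b1).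
pose s := Num.min (Num.min 1 c) (a / (b + 1)).
have s0 : 0 < s by rewrite !lt_min ltr01 c0 divr_gt0.
have sc : s <= c by rewrite /s !ge_min lexx orbT.
have s1 : s <= 1 by rewrite /s !ge_min lexx.
have sa : s * (b + 1) <= a by rewrite -ler_pdivlMr // /s ge_min lexx orbT.
exists s; first by rewrite s0.
split=> //.
have E : s *: y + (1 - s) *: x - x = s *: (y - x).
  by apply/rowP => k; rewrite !mxE; ring.
have Az : A (s *: y + (1 - s) *: x) by apply: convex_setP => //; rewrite (ltW s0).
have := ga _ Az; rewrite E enormZ gtr0_norm // -/b dotvZr => h.
apply: le_trans (h _) _; first nra.
suff : b * (c / (b + 1)) <= c.
  move=> h'; have := ler_wpM2l (ltW s0) h'; rewrite (mulrC s c).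
  by apply: le_trans; rewrite le_eqVlt; apply/orP; left; apply/eqP; ring.
by rewrite mulrA ler_pdivrMr // mulrC ler_pM2l // lerDl.
Qed.

Lemma strongly_convex_gradient (m : R) A f x y g : convex_set A ->
  0 <= m -> strongly_convex m A f -> A x -> A y -> is_gradient A f x g ->
  f x + dotv g (y - x) + m / 2 * enorm (y - x) ^+ 2 <= f y.
Proof.
move=> cA m0 sc Ax Ay gx; rewrite leNgt; apply/negP => h.
set q := enorm (y - x) ^+ 2 in h *; have q0 : 0 <= q by rewrite sqr_ge0.
set d := f x + dotv g (y - x) + m / 2 * q - f y.
have d0 : 0 < d by rewrite subr_gt0.
(* Strong convexity along the segment, divided by [s], gives [d <= c + m / 2 * s * q]. With [s <= c]
   and this [c] the right side is at most [d / 2]. *)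
pose c := d / (m * q + 2).
have mq : 0 <= m * q by rewrite mulr_ge0.
have mq2 : 0 < m * q + 2 by rewrite ltr_wpDl.
have cE : c * (m * q + 2) = d by rewrite /c divfK // gt_eqF.
have c0 : 0 < c by rewrite divr_gt0.
have [s /andP[s0 sc'] [s1]] := is_gradient_segment cA Ax Ay gx c0.
rewrite ler_norml => /andP[+ _].
have := sc y x s Ay Ax; rewrite (ltW s0) s1 -/q => /(_ isT).
move=> h1 h2; have : s * (d - m / 2 * s * q) <= s * c by rewrite /d; nra.
rewrite ler_pM2l // => h3.
have : m / 2 * s * q <= m / 2 * c * q by rewrite ler_wpM2r // ler_wpM2l // divr_ge0.
nra.
Qed.

Lemma gradient_ge0_at_min A f x y g : convex_set A -> A x -> A y ->
  is_gradient A f x g -> (forall v, A v -> f x <= f v) -> 0 <= dotv g (y - x).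
Proof.
move=> cA Ax Ay gx fx; rewrite leNgt; apply/negP => h.
(* Half the assumed slope, so that the error [c * s] cannot offset the decrease along the
   segment. *)
pose c := - dotv g (y - x) / 2.
have c0 : 0 < c by rewrite divr_gt0 // oppr_gt0.
have [s /andP[s0 sc'] [s1]] := is_gradient_segment cA Ax Ay gx c0.
rewrite ler_norml => /andP[_].
have Az : A (s *: y + (1 - s) *: x) by apply: convex_setP => //; rewrite (ltW s0).
have := fx _ Az; rewrite /c => h1 h2.
have : s * - dotv g (y - x) <= s * (- dotv g (y - x) / 2) by lra.
by rewrite ler_pM2l //; lra.
Qed.

End GradientTheory.

(** * Profiles differing in one row *)

Section ProfileTheory.
Context {R : realType} {N n : nat}.
Implicit Types (x y z : 'M[R]_(N, n)) (i j k : 'I_N) (v : 'rV[R]_n).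

Lemma row_deviate x i v j : row j (deviate x i v) = if j == i then v else row j x.
Proof. by apply/rowP => k; rewrite !mxE; case: eqP => //; rewrite !mxE. Qed.

Lemma deviate_deviate x i v w : deviate (deviate x i v) i w = deviate x i w.
Proof. by apply/row_matrixP => j; rewrite !row_deviate; case: eqP. Qed.

Lemma deviate_row x i : deviate x i (row i x) = x.
Proof. by apply/row_matrixP => j; rewrite row_deviate; case: eqP => [->|]. Qed.

Lemma deviate_profiles (X : 'I_N -> set 'rV[R]_n) x i v :
  profiles X x -> X i v -> profiles X (deviate x i v).
Proof. by move=> Xx Xv j; rewrite row_deviate; case: eqP => [->|]. Qed.

(** Telescoping through the hybrids [h m], whose first [m] rows come from [x] and the others from
    [y]. They are profiles because [X] is a product, and consecutive ones differ in a single row. *)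
Lemma row_lipschitz_sum (X : 'I_N -> set 'rV[R]_n) (F : 'M[R]_(N, n) -> 'rV[R]_n)
    (K : 'I_N -> R) :
  (forall j x y, profiles X x -> profiles X y ->
     (forall k, k != j -> row k x = row k y) ->
     enorm (F x - F y) <= K j * enorm (row j x - row j y)) ->
  forall x y, profiles X x -> profiles X y ->
    enorm (F x - F y) <= \sum_j K j * enorm (row j x - row j y).
Proof.
move=> FK x y Xx Xy.
pose h (m : nat) : 'M[R]_(N, n) := \matrix_(j < N) (if (j < m)%N then row j x else row j y).
have rh m j : row j (h m) = if (j < m)%N then row j x else row j y.
  by rewrite rowK.
have Xh m : profiles X (h m) by move=> j; rewrite rh; case: ifP.
have step (m : nat) : (m <= N)%N ->
    enorm (F (h m) - F y) <= \sum_(j < N | (j < m)%N) K j * enorm (row j x - row j y).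
  elim: m => [_|m IH mN].
    have -> : h 0%N = y by apply/row_matrixP => j; rewrite rh.
    by rewrite subrr enorm0 big_pred0.
  apply: le_trans (enorm_triangle (F (h m)) _ _) _.
  rewrite (bigD1 (Ordinal mN)) //=; apply: lerD.
    have -> : row (Ordinal mN) x = row (Ordinal mN) (h m.+1) by rewrite rh /= leqnn.
    have -> : row (Ordinal mN) y = row (Ordinal mN) (h m) by rewrite rh /= ltnn.
    apply: FK => // k km; rewrite !rh ltnS leq_eqVlt.
    by rewrite -val_eqE /= in km; rewrite (negbTE km).
  rewrite (eq_bigl (fun j : 'I_N => (j < m)%N)) ?IH 1?ltnW // => j.
  by rewrite -val_eqE /= ltnS leq_eqVlt; case: ltngtP.
have -> : x = h N by apply/row_matrixP => j; rewrite rh ltn_ord.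
apply: le_trans (step N (leqnn _)) _; rewrite (eq_bigl xpredT) => [|j]; last exact: ltn_ord.
by apply: ler_sum => j _; rewrite rh ltn_ord.
Qed.

End ProfileTheory.

(** * First-order inequalities for the costs and at equilibrium *)

Section GameTheory.
Context {R : realType} {N n : nat}.
Variables (rho D U : R) (mu : 'I_N -> R) (L : 'I_N -> 'I_N -> R).
Variables (X : 'I_N -> set 'rV[R]_n) (C : 'I_N -> 'M[R]_(N, n) -> R).
Hypotheses (n_gt0 : (0 < n)%N) (rho_gt0 : 0 < rho) (mu_gt0 : forall i, 0 < mu i).
Hypotheses (X_convex : forall i, convex_set (X i))
  (X_ball : forall i v, enorm v <= rho -> X i v)
  (C_diff : forall i x, profiles X x -> differentiable_own X C i x)
  (C_sc : forall i x, profiles X x -> strongly_convex (mu i) (X i) (own_cost C i x))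
  (C_lip : forall i j x y, profiles X x -> profiles X y ->
     (forall k, k != j -> row k x = row k y) ->
     enorm (own_gradient X C i x - own_gradient X C i y)
       <= L i j * enorm (row j x - row j y))
  (C_grad : forall i x, profiles X x -> enorm (own_gradient X C i x) <= U).
Implicit Types (x y z : 'M[R]_(N, n)) (i j k : 'I_N) (v : 'rV[R]_n).
Local Notation G := (own_gradient X C).

Lemma profiles0 : profiles X 0.
Proof. by move=> i; apply: X_ball; rewrite row0 enorm0 ltW. Qed.

(** The ball inside [X j] contains a vector of norm [rho], so the Lipschitz bound can be tested on
    two profiles whose rows [j] really differ. *)
Lemma lipschitz_ge0 i j : 0 <= L i j.
Proof.
pose v : 'rV[R]_n := rho *: delta_mx 0 (Ordinal n_gt0).
have ev : enorm v = rho.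
  rewrite enormZ gtr0_norm // /enorm /dotv (bigD1 (Ordinal n_gt0)) //= !mxE !eqxx.
  rewrite big1 => [|k /negbTE kn]; first by rewrite mulr1 addr0 sqrtr1 mulr1.
  by rewrite !mxE kn andbF mulr0.
have Xd : profiles X (deviate 0 j v).
  by apply: deviate_profiles; [exact: profiles0 | apply: X_ball; rewrite ev].
have := @C_lip i j _ _ Xd profiles0.
rewrite row_deviate eqxx row0 subr0 ev => h.
rewrite -(pmulr_lge0 _ rho_gt0); apply: le_trans (h _); first exact: enorm_ge0.
by move=> k /negbTE kj; rewrite row_deviate kj.
Qed.

Lemma own_gradientP i x : profiles X x ->
  is_gradient (X i) (own_cost C i x) (row i x) (G i x).
Proof. by move=> Xx; exact: (xgetPex 0 (C_diff i Xx)). Qed.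

Lemma cost_lower i x v : profiles X x -> X i v ->
  C i x + dotv (G i x) (v - row i x) + mu i / 2 * enorm (v - row i x) ^+ 2
    <= C i (deviate x i v).
Proof.
move=> Xx Xv.
have := strongly_convex_gradient (@X_convex i) (ltW (mu_gt0 i)) (@C_sc i x Xx) (Xx i) Xv
  (own_gradientP i Xx).
by rewrite /own_cost deviate_row.
Qed.

Lemma cost_lower_rev i x v : profiles X x -> X i v ->
  C i (deviate x i v) + dotv (G i (deviate x i v)) (row i x - v)
    + mu i / 2 * enorm (v - row i x) ^+ 2 <= C i x.
Proof.
move=> Xx Xv; have := cost_lower (deviate_profiles Xx Xv) (Xx i).
by rewrite deviate_deviate deviate_row row_deviate eqxx enormBC.
Qed.

Lemma own_gradient_lip i x v : profiles X x -> X i v ->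
  enorm (G i (deviate x i v) - G i x) <= L i i * enorm (v - row i x).
Proof.
move=> Xx Xv; have := @C_lip i i _ _ (deviate_profiles Xx Xv) Xx.
rewrite row_deviate eqxx; apply=> k /negbTE ki.
by rewrite row_deviate ki.
Qed.

Lemma cost_taylor i x v : profiles X x -> X i v ->
  `|C i (deviate x i v) - C i x - dotv (G i x) (v - row i x)|
    <= L i i * enorm (v - row i x) ^+ 2.
Proof.
move=> Xx Xv.
have h1 := cost_lower Xx Xv; have h2 := cost_lower_rev Xx Xv.
have q0 : 0 <= mu i / 2 * enorm (v - row i x) ^+ 2.
  by rewrite mulr_ge0 ?sqr_ge0 // divr_ge0 // ltW.
have h3 := le_trans (dotv_le (G i (deviate x i v) - G i x) (v - row i x))
   (ler_wpM2r (enorm_ge0 _) (own_gradient_lip Xx Xv)).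
rewrite -mulrA -expr2 dotvBl in h3.
rewrite -(opprB v) dotvNr in h2.
have l0 : 0 <= L i i * enorm (v - row i x) ^+ 2.
  by rewrite mulr_ge0 ?sqr_ge0 // lipschitz_ge0.
by rewrite ler_norml; apply/andP; split; lra.
Qed.

Lemma own_gradient_monotone i x v : profiles X x -> X i v ->
  mu i * enorm (row i x - v) ^+ 2 <= dotv (G i x - G i (deviate x i v)) (row i x - v).
Proof.
move=> Xx Xv; have h1 := cost_lower Xx Xv; have h2 := cost_lower_rev Xx Xv.
rewrite -(opprB v) dotvNr in h2; rewrite -(opprB v) dotvNr enormN dotvBl; lra.
Qed.

Lemma nash_variational xs i v : is_nash X C xs -> X i v ->
  0 <= dotv (G i xs) (v - row i xs).
Proof.
move=> [Xxs nxs] Xv.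
apply: (gradient_ge0_at_min (@X_convex i) (Xxs i) Xv (own_gradientP i Xxs)) => w Xw.
by rewrite /own_cost deviate_row nxs.
Qed.

(** Strong monotonicity holds only between profiles that differ in row [i], so [z] is compared with
    [z'], which is [z] with row [i] set to [p]. Passing from [z'] to [xs] costs the Lipschitz terms;
    at [xs] the equilibrium inequality is tested with row [i] of [z], and replacing the equilibrium
    action by [p] costs the term in [U]. *)
Lemma nash_monotone xs i z p : is_nash X C xs -> profiles X z -> X i p ->
  mu i * enorm (row i z - p) ^+ 2
    - (L i i * enorm (p - row i xs)
       + \sum_(j < N | j != i) L i j * enorm (row j z - row j xs)) * enorm (row i z - p)
    - U * enorm (p - row i xs)
  <= dotv (G i z) (row i z - p).
Proof.
move=> nxs Xz Xp; have Xxs := nxs.1.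
have h1 := own_gradient_monotone Xz Xp.
have h2 := nash_variational nxs (Xz i).
have h3 : dotv (G i xs) (p - row i xs) <= U * enorm (p - row i xs).
  by rewrite (le_trans (dotv_le _ _)) // ler_wpM2r ?enorm_ge0 // C_grad.
set z' := deviate z i p in h1 *.
have Xz' : profiles X z' by exact: deviate_profiles.
have h4 : dotv (G i xs - G i z') (row i z - p) <=
    (L i i * enorm (p - row i xs)
       + \sum_(j < N | j != i) L i j * enorm (row j z - row j xs)) * enorm (row i z - p).
  rewrite (le_trans (dotv_le _ _)) // ler_wpM2r ?enorm_ge0 // enormBC.
  apply: le_trans (row_lipschitz_sum (@C_lip i) Xz' Xxs) _.
  rewrite (bigD1 i) //= row_deviate eqxx lerD2l; apply: ler_sum => j /negbTE ji.
  by rewrite row_deviate ji.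
have -> : row i z - p = (row i z - row i xs) - (p - row i xs).
  by rewrite opprB addrA subrK.
rewrite [dotv (G i z) _](_ : _ = dotv (G i z - G i z') (row i z - p)
  - dotv (G i xs - G i z') (row i z - p) + dotv (G i xs) (row i z - row i xs)
  - dotv (G i xs) (p - row i xs)); first by rewrite opprB addrA subrK; lra.
by rewrite !(dotvBl, dotvBr); ring.
Qed.

End GameTheory.

(** * Sample paths of the algorithm *)

Section Shrink.
Context {R : realType} {n : nat}.
Variables (A : set 'rV[R]_n) (rho delta : R).
Hypotheses (rho_gt0 : 0 < rho) (delta_ge0 : 0 <= delta) (delta_lt : delta < rho).
Hypotheses (A_closed : closed A) (A_convex : convex_set A)
  (A_ball : forall v, enorm v <= rho -> A v).
Local Notation t := (1 - delta / rho).

Lemma shrink_ratio_gt0 : 0 < t.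
Proof. by rewrite subr_gt0 ltr_pdivrMr // mul1r. Qed.

Lemma shrink_scale v : A v -> shrink A rho delta (t *: v).
Proof.
move=> Av; have t0 := shrink_ratio_gt0; split; last first.
  by rewrite scalerA mulVf ?gt_eqF // scale1r.
rewrite -[_ *: v]addr0 -[X in _ + X](scaler0 _ (1 - t)); apply: convex_setP => //.
  by apply: A_ball; rewrite enorm0 ltW.
by rewrite ltW //= gerBl divr_ge0 // ltW.
Qed.

Lemma shrink0 : shrink A rho delta 0.
Proof. by split; rewrite ?scaler0; apply: A_ball; rewrite enorm0 ltW. Qed.

(** This is the purpose of [shrink]: the perturbed point is the convex combination of [t^-1 *: v],
    in [A] by definition, and [rho *: w], in the ball, with [(1 - t) * rho = delta]. *)
Lemma shrink_add v w : shrink A rho delta v -> enorm w <= 1 -> A (v + delta *: w).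
Proof.
move=> [Av Atv] w1; have t0 := shrink_ratio_gt0.
have -> : v + delta *: w = t *: (t^-1 *: v) + (1 - t) *: (rho *: w).
  rewrite !scalerA divff ?gt_eqF // scale1r; congr (_ + _ *: _).
  by field; rewrite gt_eqF.
apply: convex_setP => //.
  by apply: A_ball; rewrite enormZ gtr0_norm // ger_pMr.
by rewrite ltW //= gerBl divr_ge0 // ltW.
Qed.

Lemma shrink_closed : closed (shrink A rho delta).
Proof.
apply: closedI => //.
exact (preimage_closed (D := A) (fun z _ => @scaler_continuous _ _ _ z) A_closed).
Qed.

Lemma shrink_convex : convex_set (shrink A rho delta).
Proof.
move=> v w s /set_mem [Av Atv] /set_mem [Aw Atw]; apply/mem_set; split.
  exact: (set_mem (A_convex s (mem_set Av) (mem_set Aw))).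
have := set_mem (A_convex s (mem_set Atv) (mem_set Atw)).
by rewrite !convRE || rewrite /conv /=; rewrite !scalerDr !scalerA ![_ * t^-1]mulrC.
Qed.

End Shrink.

(** * Pathwise bounds along a run *)

Section Run.
Context {R : realType} {N n : nat}.
Variables (rho D Uc eta delta : R) (B : nat).
Variables (X : 'I_N -> set 'rV[R]_n) (C : 'I_N -> 'M[R]_(N, n) -> R).
Hypotheses (rho_gt0 : 0 < rho) (delta_gt0 : 0 < delta) (delta_lt : delta < rho)
  (eta_ge0 : 0 <= eta).
Hypotheses (X_closed : forall i, closed (X i)) (X_convex : forall i, convex_set (X i))
  (X_ball : forall i v, enorm v <= rho -> X i v)
  (C_bound : forall i x, profiles X x -> `|C i x| <= Uc).
Variables (Tup : 'I_N -> set nat) (x1 xh0 : 'M[R]_(N, n)).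
Hypotheses (Tup_async : forall i t, (1 <= t)%N -> exists2 s, Tup i s & (t <= s < t + B)%N)
  (Tup_gt0 : forall i, Tup i `<=` [set t | (1 <= t)%N])
  (x1P : forall i, shrink (X i) rho delta (row i x1)) (xh0P : profiles X xh0).
Variables (u : 'I_N -> nat -> 'rV[R]_n) (x xh : nat -> 'M[R]_(N, n)).
Hypotheses (u1 : forall i t, Tup i t -> enorm (u i t) = 1)
  (run : zo_run X C rho eta delta Tup x1 xh0 u x xh).

Lemma run_played i t : Tup i t -> row i (xh t) = row i (x t) + delta *: u i t.
Proof.
by move=> it; case: run => _ _ h _; rewrite h ?mem_set //; exact: Tup_gt0 it.
Qed.

Lemma run_played_idle i t : (1 <= t)%N -> ~ Tup i t -> row i (xh t) = row i (xh t.-1).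
Proof. by move=> t1 it; case: run => _ _ h _; rewrite h // memNset. Qed.

Lemma run_updated i t : Tup i t -> row i (x t.+1) =
  proj (shrink (X i) rho delta)
    (row i (x t) - eta *: ((n%:R / delta * C i (xh t)) *: u i t)).
Proof.
by move=> it; case: run => _ _ _ h; rewrite h ?mem_set //; exact: Tup_gt0 it.
Qed.

Lemma run_idle i t : (1 <= t)%N -> ~ Tup i t -> row i (x t.+1) = row i (x t).
Proof. by move=> t1 it; case: run => _ _ _ h; rewrite h // memNset. Qed.

Lemma run_shrink i t : (1 <= t)%N -> shrink (X i) rho delta (row i (x t)).
Proof.
elim: t => // -[_ _|t /(_ isT) IH _]; first by case: run => -> _ _ _.
have [it|it] := pselect (Tup i t.+1); last by rewrite run_idle.
rewrite run_updated //; apply: proj_in.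
- exact: shrink0 (@X_ball i).
- exact: shrink_closed.
Qed.

Lemma run_in i t : (1 <= t)%N -> X i (row i (x t)).
Proof. by move=> t1; have [] := @run_shrink i t t1. Qed.

Lemma run_profiles t : profiles X (xh t).
Proof.
elim: t => [|t IH] i; first by case: run => _ -> _ _; exact: xh0P.
have [it|it] := pselect (Tup i t.+1); last by rewrite run_played_idle.
rewrite run_played //.
apply: (shrink_add rho_gt0 (ltW delta_gt0) delta_lt (@X_convex i) (@X_ball i)).
  exact: run_shrink.
by rewrite u1.
Qed.

(** Bound on the length of one gradient step, from unit directions and costs at most [Uc]. *)
Definition step_bound := eta * (n%:R / delta * Uc).

Lemma Uc_ge0 (i : 'I_N) : 0 <= Uc.
Proof. exact: le_trans (normr_ge0 _) (@C_bound i _ xh0P). Qed.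

Lemma grad_est_bound i t : Tup i t ->
  enorm (eta *: ((n%:R / delta * C i (xh t)) *: u i t)) <= step_bound.
Proof.
move=> it; rewrite !enormZ u1 // mulr1 ger0_norm // /step_bound ler_wpM2l //.
have nd0 : 0 <= n%:R / delta by rewrite divr_ge0 // ltW.
rewrite normrM ger0_norm // ler_wpM2l //.
exact: C_bound (run_profiles _).
Qed.

Lemma step_bound_ge0 (i : 'I_N) : 0 <= step_bound.
Proof. by rewrite mulr_ge0 // mulr_ge0 ?(Uc_ge0 i) // divr_ge0 // ltW. Qed.

Lemma run_step_le i t : (1 <= t)%N -> enorm (row i (x t.+1) - row i (x t)) <= step_bound.
Proof.
move=> t1; have [it|it] := pselect (Tup i t); last first.
  by rewrite run_idle // subrr enorm0 (step_bound_ge0 i).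
rewrite run_updated //; apply: le_trans (proj_le _ _ _ _ (run_shrink i t1)) _.
- exact: shrink0 (@X_ball i).
- exact: shrink_closed.
- exact: shrink_convex.
by rewrite addrC addKr enormN grad_est_bound.
Qed.

(** The projection fixes [p] and is nonexpansive, so the squared distance of the unprojected step to
    [p] is expanded. *)
Lemma run_contraction i t p : Tup i t -> shrink (X i) rho delta p ->
  enorm (row i (x t.+1) - p) ^+ 2 <= enorm (row i (x t) - p) ^+ 2
    - 2 * eta * (n%:R / delta) * (C i (xh t) * dotv (u i t) (row i (x t) - p))
    + step_bound ^+ 2.
Proof.
move=> it Xp; rewrite run_updated //.
set g := eta *: _.
apply: (@le_trans _ _ (enorm ((row i (x t) - p) - g) ^+ 2)).
  rewrite ler_pXn2r ?nnegrE ?enorm_ge0 //.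
  rewrite (_ : row i (x t) - p - g = row i (x t) - g - p); last by rewrite addrAC.
  by apply: proj_le => //; [exact: shrink0 (@X_ball i) | exact: shrink_closed
    | exact: shrink_convex].
rewrite (enorm_sqB (row i (x t) - p)); apply: lerD; last first.
  by rewrite ler_pXn2r ?nnegrE ?enorm_ge0 ?(step_bound_ge0 i) // grad_est_bound.
by rewrite lerD2l lerN2 /g !dotvZr (dotvC (u i t)) le_eqVlt; apply/orP; left; apply/eqP; ring.
Qed.

(** The played action is compared with the next iterate [x t.+1], because at an idle time both keep
    their previous values; an update resets their distance to at most [delta] plus one step. *)
Lemma run_lag_after i s t : Tup i s -> (s <= t)%N ->
  enorm (row i (xh t) - row i (x t.+1)) <= delta + step_bound.
Proof.
move=> is_; elim: t => [|t IH] st.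
  by have := Tup_gt0 is_; move: st; rewrite leqn0 => /eqP -> /=.
have [it|it] := pselect (Tup i t.+1).
  apply: le_trans (enorm_triangle (row i (x t.+1)) _ _) _; apply: lerD.
    by rewrite run_played // addrAC subrr add0r enormZ u1 // mulr1 gtr0_norm.
  by rewrite enormBC run_step_le.
rewrite run_played_idle // run_idle //; apply: IH.
by rewrite -ltnS ltn_neqAle st andbT; apply/eqP => e; apply: it; rewrite -e.
Qed.

(** Before its first update an agent plays its initial value in [xh0], which may be far from its
    iterate. The window starting at time 1 contains an update at some [s <= B], hence the condition
    [B <= t]. *)
Lemma run_lag i t : (B <= t)%N -> enorm (row i (xh t) - row i (x t)) <= delta + step_bound.
Proof.
move=> Bt; have [s is_ /andP[s1 sB]] := @Tup_async i 1%N isT.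
have st : (s <= t)%N by rewrite (leq_trans _ Bt) // -ltnS -add1n.
have t0 : (0 < t)%N := leq_trans s1 st.
have [it|it] := pselect (Tup i t).
  rewrite run_played // addrAC subrr add0r enormZ u1 // mulr1 gtr0_norm //.
  by rewrite lerDl (step_bound_ge0 i).
rewrite run_played_idle // -[in x t](prednK t0); apply: (run_lag_after is_).
rewrite -ltnS prednK // ltn_neqAle st andbT.
by apply/eqP => e; apply: it; rewrite -e.
Qed.

End Run.

(** * Measurability *)

Section BorelMatrices.
Context {R : realType}.

(** Boxes with rational centre and radius [1 / (k + 1)] form a countable family. The inclusion of
    the box in [A] is part of the indexed set, so boxes leaving [A] contribute nothing and the index
    type needs no restriction. *)
Lemma open_mx_boxes {m n : nat} (A : set 'M[R]_(m, n)) : open A ->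
  A = \bigcup_(qk : 'M[rat]_(m, n) * nat)
    [set M : 'M[R]_(m, n) |
      (forall M' : 'M[R]_(m, n),
        (forall i j, `|M' i j - ratr (qk.1 i j)| < qk.2.+1%:R^-1) -> A M')
      /\ forall i j, `|M i j - ratr (qk.1 i j)| < qk.2.+1%:R^-1].
Proof.
move=> oA; apply/seteqP; split=> [M AM|M [qk _ /= [qA qM]]]; last exact: qA.
have /nbhs_ballP[e /= e0 eA] : nbhs M A by move: oA; rewrite openE; exact.
have [k] := @ltr_add_invr R 0 (e / 2) (divr_gt0 e0 (ltr0Sn _ _)).
rewrite add0r => ke; set a : R := k.+1%:R^-1 in ke.
have a0 : 0 < a by rewrite invr_gt0.
have /choice[q qP] : forall ij : 'I_m * 'I_n, exists q : rat, `|M ij.1 ij.2 - ratr q| < a.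
  move=> [i j] /=; have [q] := @rat_in_itvoo R (M i j - a) (M i j + a) ltac:(lra).
  by rewrite in_itv /= => /andP[h1 h2]; exists q; rewrite ltr_norml; lra.
exists (\matrix_(i, j) q (i, j), k) => //=; split=> [M' h|i j]; last first.
  by rewrite mxE; exact: (qP (i, j)).
apply: eA; split=> // i j; rewrite /ball /=.
rewrite (_ : _ - _ = (M i j - ratr (q (i, j))) - (M' i j - ratr (q (i, j)))).
  have h1 := qP (i, j); have := h i j; rewrite mxE -/a => h2.
  by apply: le_lt_trans (ler_normB _ _) _; rewrite /= in h1; lra.
by ring.
Qed.

Context {d : measure_display} {T : measurableType d}.

(** Open sets generate the Borel sigma-algebra, and the preimage of a box is a finite intersection
    of preimages under the coordinates. *)
Lemma measurable_mx {m n : nat} (f : T -> 'M[R]_(m, n)) :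
  (forall i j, measurable_fun setT (fun w => f w i j)) ->
  measurable_fun setT (f : T -> borel_mx R m n).
Proof.
move=> mf; apply: (@measurability _ _ _ (borel_mx R m n) setT f (@open 'M[R]_(m, n))) => //.
move=> _ [A oA <-].
rewrite setTI (open_mx_boxes oA) preimage_bigcup.
apply: countable_bigcupT_measurable => [|[q k]]; first exact: countableP.
have [qA|qA] := pselect (forall M' : 'M[R]_(m, n),
    (forall i j, `|M' i j - ratr (q i j)| < k.+1%:R^-1) -> A M');
  last by rewrite (_ : _ @^-1` _ = set0) //; apply/seteqP; split=> // w [/qA].
rewrite (_ : _ @^-1` _ = \bigcap_(ij in [set: 'I_m * 'I_n])
  ((fun w => f w ij.1 ij.2) @^-1` ball (ratr (q ij.1 ij.2) : R) k.+1%:R^-1)).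
  apply: fin_bigcap_measurable => // ij _; rewrite -[X in measurable X]setTI.
  by apply: mf => //; exact: measurable_ball.
apply/seteqP; split=> [w [_ h] [i j] _ /=|w h].
  by rewrite /ball /= distrC; exact: h.
by split=> // i j; have := h (i, j) I; rewrite /= /ball /= distrC.
Qed.

Lemma continuous_measurable_mx {m n : nat} (f : 'M[R]_(m, n) -> R) :
  continuous f -> measurable_fun setT (f : borel_mx R m n -> R).
Proof.
move=> /continuousP cf; apply: (measurability _ (RGenOpens.measurableE R)).
move=> _ [_ [a [b ->] <-]]; rewrite setTI.
by apply: sub_sigma_algebra; apply: cf; exact: interval_open.
Qed.

Lemma measurable_comp_mx {m n : nat} (g : 'M[R]_(m, n) -> R) (f : T -> 'M[R]_(m, n)) :
  continuous g -> (forall i j, measurable_fun setT (fun w => f w i j)) ->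
  measurable_fun setT (fun w => g (f w)).
Proof.
move=> cg mf; exact: (measurableT_comp (continuous_measurable_mx cg) (measurable_mx mf)).
Qed.

Context {n : nat}.
Implicit Types (f g : T -> 'rV[R]_n).

Definition measurable_rv f := forall c, measurable_fun setT (fun w => f w 0 c).

Lemma measurable_rv_comp (h : 'rV[R]_n -> R) f : continuous h -> measurable_rv f ->
  measurable_fun setT (fun w => h (f w)).
Proof. by move=> ch mf; apply: measurable_comp_mx => // i j; rewrite (ord1 i). Qed.

Lemma measurable_rv_cst v : measurable_rv (fun=> v).
Proof. by move=> c; exact: measurable_cst. Qed.

Lemma measurable_rvD f g : measurable_rv f -> measurable_rv g ->
  measurable_rv (fun w => f w + g w).
Proof.
move=> mf mg c; under eq_fun do rewrite mxE.
exact: measurable_funD.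
Qed.

Lemma measurable_rvZ (a : T -> R) f : measurable_fun setT a -> measurable_rv f ->
  measurable_rv (fun w => a w *: f w).
Proof.
move=> ma mf c; under eq_fun do rewrite mxE.
exact: measurable_funM.
Qed.

Lemma measurable_rvB f g : measurable_rv f -> measurable_rv g ->
  measurable_rv (fun w => f w - g w).
Proof.
move=> mf mg c; under eq_fun do rewrite !mxE.
exact: measurable_funB.
Qed.

Lemma measurable_enorm f : measurable_rv f -> measurable_fun setT (fun w => enorm (f w)).
Proof.
apply: measurable_rv_comp; apply: (@lipschitz_continuous _ _ _ 1) => u v.
by rewrite mul1r enorm_lipschitz.
Qed.

Lemma measurable_proj (A : set 'rV[R]_n) f : A 0 -> closed A -> convex_set A ->
  measurable_rv f -> measurable_rv (fun w => proj A (f w)).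
Proof.
move=> A0 clA cA mf c.
apply: (@measurable_rv_comp (fun v => proj A v 0 c)) => //.
apply: (@lipschitz_continuous _ _ _ 1) => u v; rewrite mul1r.
apply: le_trans (proj_nonexpansive A0 clA cA u v).
by apply: le_trans (coord_le_enorm _ c); rewrite !mxE.
Qed.

Lemma borel_rv_coord f : measurable_fun setT (f : T -> borel_mx R 1 n) -> measurable_rv f.
Proof.
move=> mf c.
exact: (measurableT_comp (continuous_measurable_mx (@coord_continuous _ _ _ 0 c)) mf).
Qed.

End BorelMatrices.

(** * Measurability of costs and iterates *)

Section GameMeasurability.
Context {R : realType} {N n : nat} {d : measure_display} {T : measurableType d}.
Variables (X : 'I_N -> set 'rV[R]_n) (C : 'I_N -> 'M[R]_(N, n) -> R).
Hypotheses (X_closed : forall i, closed (X i))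
  (C_meas : forall i, measurable_fun (profiles X : set (borel_mx R N n)) (C i)).

Lemma continuous_row i : continuous (fun M : 'M[R]_(N, n) => row i M).
Proof.
move=> M A /nbhs_ballP[e /= e0 eA]; apply/nbhs_ballP; exists e => // M' [_ MM'].
by apply: eA; split=> // j k; rewrite !mxE; exact: MM'.
Qed.

Lemma profiles_closed : closed (profiles X).
Proof.
rewrite (_ : profiles X = \bigcap_(i in [set: 'I_N]) ((fun M => row i M) @^-1` X i)).
  apply: closed_bigI => i _.
  exact (preimage_closed (fun z _ => @continuous_row i z) (@X_closed i)).
by apply/seteqP; split=> [M h i _|M h i]; [exact: h|exact: h].
Qed.

(** The cost is measurable on the closed set of profiles only, so the composition uses that [M]
    takes its values there. *)
Lemma measurable_cost i (M : T -> 'M[R]_(N, n)) : (forall w, profiles X (M w)) ->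
  (forall j, measurable_rv (fun w => row j (M w))) ->
  measurable_fun setT (fun w => C i (M w)).
Proof.
move=> XM mM; apply: (measurable_comp (F := (profiles X : set (borel_mx R N n))) _ _ (@C_meas i)).
- rewrite -(setCK (profiles X)); apply: measurableC; apply: sub_sigma_algebra.
  by rewrite /= openC; exact: profiles_closed.
- by move=> _ [w _ <-]; exact: XM.
- apply: measurable_mx => j c.
  by have := mM j c; under eq_fun do rewrite mxE.
Qed.

Variables (rho Uc eta delta : R).
Hypotheses (rho_gt0 : 0 < rho) (X_convex : forall i, convex_set (X i))
  (X_ball : forall i v, enorm v <= rho -> X i v).
Variables (Tup : 'I_N -> set nat) (x1 xh0 : 'M[R]_(N, n)).
Variables (u : 'I_N -> nat -> T -> 'rV[R]_n) (x xh : T -> nat -> 'M[R]_(N, n)).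
Hypotheses (run : forall w, zo_run X C rho eta delta Tup x1 xh0 (fun i t => u i t w) (x w) (xh w)).
Hypothesis xhP : forall w t, profiles X (xh w t).

Lemma measurable_played i t : (1 <= t)%N ->
  (Tup i t -> measurable_rv (u i t)) ->
  measurable_rv (fun w => row i (x w t)) -> measurable_rv (fun w => row i (xh w t.-1)) ->
  measurable_rv (fun w => row i (xh w t)).
Proof.
move=> t1 mu mx mxh.
have E w : row i (xh w t) = if t \in Tup i then row i (x w t) + delta *: u i t w
                       else row i (xh w t.-1) by have [_ _ -> //] := run w.
have [it|it] := pselect (Tup i t); last by under eq_fun do rewrite E memNset //.
under eq_fun do rewrite E mem_set //.
apply: measurable_rvD => //.
by apply: measurable_rvZ; [exact: measurable_cst | exact: mu].
Qed.

Lemma measurable_updated i t : (1 <= t)%N ->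
  (Tup i t -> measurable_rv (u i t)) ->
  measurable_rv (fun w => row i (x w t)) ->
  (forall j, measurable_rv (fun w => row j (xh w t))) ->
  measurable_rv (fun w => row i (x w t.+1)).
Proof.
move=> t1 mu mx mxh.
have E w : row i (x w t.+1) = if t \in Tup i then
            proj (shrink (X i) rho delta)
              (row i (x w t) - eta *: ((n%:R / delta * C i (xh w t)) *: u i t w))
          else row i (x w t) by have [_ _ _ -> //] := run w.
have [it|it] := pselect (Tup i t); last by under eq_fun do rewrite E memNset //.
under eq_fun do rewrite E mem_set //.
apply: measurable_proj.
- exact: shrink0 (@X_ball i).
- exact: shrink_closed.
- exact: shrink_convex.
apply: measurable_rvB => //; apply: measurable_rvZ; first exact: measurable_cst.
apply: measurable_rvZ; last exact: mu.
by apply: measurable_funM; [exact: measurable_cst | exact: measurable_cost].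
Qed.

(** [x t] is paired with [xh t.-1] because both involve only directions drawn before [t].
    Measurability is assumed of those directions alone and [T] is arbitrary, so the lemma also
    applies to the sigma-algebra that leaves out one direction of time [t]. *)
Lemma measurable_run t :
  (forall j s, (s < t)%N -> Tup j s -> measurable_rv (u j s)) ->
  (0 < t)%N -> forall j, measurable_rv (fun w => row j (x w t)) /\
    measurable_rv (fun w => row j (xh w t.-1)).
Proof.
elim: t => // -[_ _ _ j|t IH mu _].
  split=> /=; [under eq_fun do rewrite (let: And4 e _ _ _ := run _ in e)
    | under eq_fun do rewrite (let: And4 _ e _ _ := run _ in e)]; exact: measurable_rv_cst.
have {}IH := IH (fun j s st => mu j s (ltnW st)) isT.
have mxh j : measurable_rv (fun w => row j (xh w t.+1)).
  by apply: measurable_played => //; [exact: mu | exact: (IH j).1 | exact: (IH j).2].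
move=> j; split=> //; apply: measurable_updated => //; first exact: mu.
exact: (IH j).1.
Qed.

End GameMeasurability.

(** * Independence and expectation *)

Section Independence.
Context {R : realType} {dO : measure_display} {Om : measurableType dO}.
Variable P : probability Om R.
Context {I : eqType} {K : set I} {dV : measure_display} {S : measurableType dV}.
Variables (V : I -> Om -> S) (k0 : I).
Hypotheses (ind : mutually_independent P K V) (Kk0 : K k0)
  (V_meas : forall k, K k -> measurable_fun setT (V k)).

(** The pi-system of finite-dimensional events that do not involve the index [k0]. *)
Definition cylinders : set (set Om) :=
  [set E | exists s (A : I -> set S), [/\ uniq s, forall k, k \in s -> K k /\ k != k0,
     forall k, measurable (A k) & E = \bigcap_(k in [set` s]) (V k @^-1` A k)]].

Lemma preimage_meas k A : K k -> measurable A -> measurable (V k @^-1` A).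
Proof. by move=> Kk mA; rewrite -[X in measurable X]setTI; exact: V_meas. Qed.

Lemma cylinders_setI : setI_closed cylinders.
Proof.
move=> _ _ [s [A [us sK mA ->]]] [s' [A' [us' sK' mA' ->]]].
(* Independence is stated for distinct indices, hence [undup]; an index missing from one family is
   padded with [setT]. *)
exists (undup (s ++ s')), (fun k => (if k \in s then A k else setT) `&`
  (if k \in s' then A' k else setT)); split.
- exact: undup_uniq.
- by move=> k; rewrite mem_undup mem_cat => /orP[/sK|/sK'].
- by move=> k; apply: measurableI; case: ifP.
apply/seteqP; split=> [w [h h'] k /= _|w h].
  by split; case: ifP => // ks; [exact: h|exact: h'].
by split=> k /= ks; have := h k; rewrite /= mem_undup mem_cat ks ?orbT => /(_ isT) [].
Qed.

Lemma cylinders_measurable E : <<s cylinders >> E -> measurable E.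
Proof.
apply: smallest_sub; first exact: sigma_algebra_measurable.
move=> _ [s [A [us sK mA ->]]]; apply: fin_bigcap_measurable => [|k /= /sK [Kk _]].
  exact: finite_seq.
exact: preimage_meas.
Qed.

(* [Om] with the sigma-algebra generated by the [V k], [k != k0]. *)
Definition rest := g_sigma_algebraType cylinders.

Lemma rest_measurable k : K k -> k != k0 -> measurable_fun setT (V k : rest -> S).
Proof.
move=> Kk kk0 _ A mA; rewrite setTI; apply: sub_sigma_algebra.
exists [:: k], (fun=> A); split=> // [j|]; first by rewrite inE => /eqP ->.
apply/seteqP; split=> [w h j /=|w h]; first by rewrite inE => /eqP ->.
by have := h k; rewrite /= inE eqxx; exact.
Qed.

Lemma measurable_of_rest d' (S' : measurableType d') (f : Om -> S') :
  measurable_fun setT (f : rest -> S') -> measurable_fun setT f.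
Proof.
by move=> mf mT A mA; apply: cylinders_measurable; exact: mf.
Qed.

(** On a cylinder over [s], mutual independence is applied both to [s] and to [k0 :: s]. Complements
    follow by subtraction and disjoint unions by countable additivity. *)
Lemma rest_independent E A : <<s cylinders >> E -> measurable A ->
  P (E `&` V k0 @^-1` A) = (P E * P (V k0 @^-1` A))%E.
Proof.
move=> cE mA; set F := V k0 @^-1` A.
have mF : measurable F by exact: preimage_meas.
have PF : P F = (fine (P F))%:E by rewrite fineK // fin_num_measure.
apply: (@dynkin_induction _ rest cylinders
   (fun E => P (E `&` F) = (P E * P F)%E)) cE => //.
- exact: cylinders_setI.
- by rewrite setTI probability_setT mul1e.
- move=> _ [s [B [us sK mB ->]]].
  have k0s : k0 \notin s by apply/negP => /sK [_]; rewrite eqxx.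
  rewrite (ind us (fun k ks => (sK k ks).1) mB).
  have := ind (s := k0 :: s) (A := fun k => if k == k0 then A else B k).
  rewrite big_cons eqxx muleC => h.
  rewrite (eq_big_seq (fun k => P (V k @^-1` (if k == k0 then A else B k)))); last first.
    by move=> k /sK [_ /negbTE ->].
  rewrite -h /=; first 1 last.
  + by rewrite k0s.
  + by move=> k; rewrite inE => /predU1P[->|/sK []].
  + by move=> k; case: ifP.
  congr (P _); apply/seteqP; split=> [w [h1 h2] k /=|w h1].
    rewrite inE => /predU1P[->|ks]; first by rewrite eqxx.
    by have [_ /negbTE ->] := sK k ks; exact: h1.
  split=> [k /= ks|].
    have := h1 k; rewrite /= inE ks orbT => /(_ isT).
    by have [_ /negbTE ->] := sK k ks.
  by have := h1 k0; rewrite /= inE eqxx => /(_ isT).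
- move=> E' /cylinders_measurable mE' h.
  have Ffin : (P F < +oo)%E by rewrite PF ltry.
  have PD : P (F `\` E') = (P F - P (F `&` E'))%E by exact: measureD.
  rewrite setIC -setDE PD setIC h probability_setC //.
  have -> : P E' = (fine (P E'))%:E by rewrite fineK // fin_num_measure.
  rewrite PF; set a := fine (P E'); set b := fine (P F).
  by transitivity (((1 - a) * b)%:E); rewrite // mulrBl mul1r.
- move=> G mG tG h.
  have mG' k : @measurable _ Om (G k) by exact: cylinders_measurable (mG k).
  have PG : P (\bigcup_k (G k `&` F)) = (\sum_(k <oo) P (G k `&` F))%E.
    apply: measure_semi_bigcup; first by move=> k; exact: measurableI.
      by apply: trivIset_setIr.
    by apply: bigcupT_measurable => k; exact: measurableI.
  have PG' : P (\bigcup_k G k) = (\sum_(k <oo) P (G k))%E.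
    by apply: measure_semi_bigcup => //; exact: bigcupT_measurable.
  rewrite setI_bigcupl PG (eq_eseriesr (g := fun k => (P F * P (G k))%E)); last first.
    by move=> k _; rewrite h muleC.
  by rewrite PF nneseriesZl // PG' muleC.
Qed.

End Independence.

(** * Expectations of bounded random variables *)

Section Expectation.
Context {R : realType} {dO : measure_display} {Om : measurableType dO}.
Variable P : probability Om R.
Implicit Types X Y : Om -> R.

(** Closed under sums and products and integrable for any probability, so this single condition
    supplies every integrability side goal. *)
Definition bdd_meas X := measurable_fun setT X /\ exists K : R, forall w, `|X w| <= K.

Lemma bdd_meas_integrable X : bdd_meas X -> P.-integrable setT (EFin \o X).
Proof.
move=> [mX [K XK]]; apply: measurable_bounded_integrable => //.
  by rewrite /= probability_setT ltry.
exists K; split; first exact: num_real.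
by move=> K' KK' w _ /=; rewrite (le_trans (XK w)) // ltW.
Qed.

Lemma bdd_meas_cst c : bdd_meas (fun=> c).
Proof. by split; [exact: measurable_cst | exists `|c|]. Qed.

Lemma bdd_measD X Y : bdd_meas X -> bdd_meas Y -> bdd_meas (fun w => X w + Y w).
Proof.
move=> [mX [K XK]] [mY [K' YK]]; split; first exact: measurable_funD.
by exists (K + K') => w; rewrite (le_trans (ler_normD _ _)) // lerD.
Qed.

Lemma bdd_measM X Y : bdd_meas X -> bdd_meas Y -> bdd_meas (fun w => X w * Y w).
Proof.
move=> [mX [K XK]] [mY [K' YK]]; split; first exact: measurable_funM.
by exists (K * K') => w; rewrite normrM ler_pM.
Qed.

Lemma bdd_measZ c X : bdd_meas X -> bdd_meas (fun w => c * X w).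
Proof. by move=> bX; apply: bdd_measM => //; exact: bdd_meas_cst. Qed.

Lemma bdd_measB X Y : bdd_meas X -> bdd_meas Y -> bdd_meas (fun w => X w - Y w).
Proof.
move=> [mX [K XK]] [mY [K' YK]]; split; first exact: measurable_funB.
by exists (K + K') => w; rewrite (le_trans (ler_normB _ _)) // lerD.
Qed.

Lemma bdd_meas_sum (J : Type) (s : seq J) (Q : pred J) (X : J -> Om -> R) :
  (forall j, Q j -> bdd_meas (X j)) -> bdd_meas (fun w => \sum_(j <- s | Q j) X j w).
Proof.
move=> bX; elim: s => [|j s IH].
  by under eq_fun do rewrite big_nil; exact: bdd_meas_cst.
under eq_fun do rewrite big_cons.
by case Qj : (Q j) => //; apply: bdd_measD => //; exact: bX.
Qed.

Definition Ex X : R := Rintegral P setT X.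

Lemma ExD X Y : bdd_meas X -> bdd_meas Y -> Ex (fun w => X w + Y w) = Ex X + Ex Y.
Proof. by move=> bX bY; rewrite /Ex RintegralD //; exact: bdd_meas_integrable. Qed.

Lemma ExB X Y : bdd_meas X -> bdd_meas Y -> Ex (fun w => X w - Y w) = Ex X - Ex Y.
Proof. by move=> bX bY; rewrite /Ex RintegralB //; exact: bdd_meas_integrable. Qed.

Lemma ExZ c X : bdd_meas X -> Ex (fun w => c * X w) = c * Ex X.
Proof. by move=> bX; rewrite /Ex RintegralZl //; exact: bdd_meas_integrable. Qed.

Lemma Ex_cst c : Ex (fun=> c) = c.
Proof. by rewrite /Ex Rintegral_cst //= probability_setT mulr1. Qed.

Lemma Ex_le X Y : bdd_meas X -> bdd_meas Y -> (forall w, X w <= Y w) -> Ex X <= Ex Y.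
Proof.
by move=> bX bY XY; apply: le_Rintegral => //; exact: bdd_meas_integrable.
Qed.

Lemma Ex_sum (J : Type) (s : seq J) (Q : pred J) (X : J -> Om -> R) :
  (forall j, Q j -> bdd_meas (X j)) ->
  Ex (fun w => \sum_(j <- s | Q j) X j w) = \sum_(j <- s | Q j) Ex (X j).
Proof.
move=> bX; elim: s => [|j s IH].
  by under eq_fun do rewrite big_nil; rewrite Ex_cst big_nil.
under eq_fun do rewrite big_cons; rewrite big_cons.
case Qj : (Q j) => //; rewrite ExD ?IH //; first exact: bX.
exact: bdd_meas_sum.
Qed.

Lemma Ex_expectation X : bdd_meas X -> ('E_P[X] = (Ex X)%:E)%E.
Proof.
move=> bX; rewrite unlock /Ex /Rintegral fineK //.
by apply: integrable_fin_num => //; exact: bdd_meas_integrable.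
Qed.

(** The product formula on rectangles identifies the joint law of the pair with the product of the
    two laws, and Fubini then splits the integral. *)
Lemma Ex_mul_indep X Y : bdd_meas X -> bdd_meas Y ->
  (forall A B, measurable A -> measurable B ->
     P (X @^-1` A `&` Y @^-1` B) = (P (X @^-1` A) * P (Y @^-1` B))%E) ->
  Ex (fun w => X w * Y w) = Ex X * Ex Y.
Proof.
move=> bX bY indXY; have [mX [K XK]] := bX; have [mY [K' YK]] := bY.
pose X' : {mfun Om >-> R} := HB.pack X (isMeasurableFun.Build _ _ _ _ X mX).
pose Y' : {mfun Om >-> R} := HB.pack Y (isMeasurableFun.Build _ _ _ _ Y mY).
pose Z : Om -> R * R := fun w => (X w, Y w).
have mZ : measurable_fun setT Z by exact: measurable_fun_pair.
pose Z' : {mfun Om >-> (R * R)%type} := HB.pack Z (isMeasurableFun.Build _ _ _ _ Z mZ).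
pose m1 := distribution P X'; pose m2 := distribution P Y'; pose m := distribution P Z'.
pose f : R * R -> \bar R := fun z => (z.1 * z.2)%:E.
have mf : measurable_fun setT f.
  by apply/measurable_EFinP; apply: measurable_funM;
    [exact: measurable_fst | exact: measurable_snd].
have iXY : P.-integrable setT (EFin \o (fun w => X w * Y w)).
  by apply: bdd_meas_integrable; exact: bdd_measM.
have mE A : measurable A -> (m1 \x m2)%E A = m A.
  by move=> mA; exact: product_measure_unique.
have If : m.-integrable setT f.
  by apply: integrable_pushforward => //; rewrite preimage_setT.
have If' : (m1 \x m2)%E.-integrable setT f.
  apply/integrableP; split=> //.
  rewrite (eq_measure_integral m) => [|A mA _]; last exact: mE.
  by have /integrableP[] := If.
have h1 : (\int[P]_w (X w * Y w)%:E = \int[m1 \x m2]_z f z)%E.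
  rewrite (eq_measure_integral m) => [|A mA _]; last exact: mE.
  by rewrite /m integral_pushforward // preimage_setT.
have iX := bdd_meas_integrable bX; have iY := bdd_meas_integrable bY.
have mEFin : measurable_fun setT (EFin : R -> \bar R) by exact/measurable_EFinP.
have i1 : m1.-integrable setT (EFin : R -> \bar R).
  by apply: integrable_pushforward => //; rewrite preimage_setT.
have i2 : m2.-integrable setT (EFin : R -> \bar R).
  by apply: integrable_pushforward => //; rewrite preimage_setT.
have h2 : (\int[m2]_y y%:E = (Ex Y)%:E)%E.
  rewrite /m2 integral_pushforward // ?preimage_setT //.
  by rewrite /Ex /Rintegral fineK //; exact: integrable_fin_num.
have h3 : (\int[m1]_y y%:E = (Ex X)%:E)%E.
  rewrite /m1 integral_pushforward // ?preimage_setT //.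
  by rewrite /Ex /Rintegral fineK //; exact: integrable_fin_num.
rewrite {1}/Ex /Rintegral h1 -(integral12_prod_meas1 If').
rewrite (eq_integral (fun x : R => (x%:E * (Ex Y)%:E)%E)) => [|x _].
  by rewrite integralZr // h3.
by rewrite /fubini_F /f /= -h2 -integralZl.
Qed.

End Expectation.

(** * Moments of the uniform direction *)

Section EqualLaw.
Context {R : realType} {dO : measure_display} {Om : measurableType dO}.
Variable P : probability Om R.

Lemma Ex_eq_law (X Y : Om -> R) : bdd_meas X -> bdd_meas Y ->
  (forall A, measurable A -> P (X @^-1` A) = P (Y @^-1` A)) -> Ex P X = Ex P Y.
Proof.
move=> bX bY XY; have [mX _] := bX; have [mY _] := bY.
pose X' : {mfun Om >-> R} := HB.pack X (isMeasurableFun.Build _ _ _ _ X mX).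
pose Y' : {mfun Om >-> R} := HB.pack Y (isMeasurableFun.Build _ _ _ _ Y mY).
have mEFin : measurable_fun setT (EFin : R -> \bar R) by exact/measurable_EFinP.
rewrite /Ex /Rintegral; congr fine.
transitivity (\int[distribution P X']_y y%:E)%E.
  by rewrite integral_distribution //; exact: bdd_meas_integrable.
transitivity (\int[distribution P Y']_y y%:E)%E.
  by apply: eq_measure_integral => A mA _; exact: XY.
by rewrite integral_distribution //; exact: bdd_meas_integrable.
Qed.

End EqualLaw.

Section SphereMoments.
Context {R : realType} {dO : measure_display} {Om : measurableType dO}.
Variable P : probability Om R.
Context {n : nat}.
Variable V : Om -> 'rV[R]_n.
Hypothesis V_unif : uniform_on_sphere P V.

Lemma sphere_measurable : measurable_rv V.
Proof. by case: V_unif => mV _ _; exact: borel_rv_coord. Qed.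

Lemma sphere_coord k : bdd_meas (fun w => V w 0 k).
Proof.
split; first exact: sphere_measurable.
by exists 1 => w; case: V_unif => _ hV _; rewrite -(hV w) coord_le_enorm.
Qed.

Lemma sphere_invariant (phi : 'rV[R]_n -> R) (Q : 'M[R]_n) : continuous phi ->
  Q *m Q^T = 1%:M -> bdd_meas (fun w => phi (V w)) -> bdd_meas (fun w => phi (V w *m Q)) ->
  Ex P (fun w => phi (V w *m Q)) = Ex P (fun w => phi (V w)).
Proof.
move=> cphi QQ b1 b2; apply: Ex_eq_law => // A mA.
case: V_unif => _ _ /(_ Q QQ (phi @^-1` A)); apply.
by rewrite -[X in measurable X]setTI; exact: continuous_measurable_mx.
Qed.

(** Invariance under minus the identity makes the mean equal to its opposite. *)
Lemma sphere_mean k : Ex P (fun w => V w 0 k) = 0.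
Proof.
have E w : (V w *m (- 1%:M)) 0 k = -1 * V w 0 k by rewrite mulmxN mulmx1 mxE mulN1r.
have := @sphere_invariant (fun v => v 0 k) (- 1%:M) (@coord_continuous _ _ _ 0 k).
rewrite linearN /= trmx1 mulmxN mulNmx opprK mulmx1 => /(_ erefl (sphere_coord k)).
under eq_fun do rewrite E.
move=> /(_ (bdd_measZ (-1) (sphere_coord k))).
by rewrite ExZ; [lra | exact: sphere_coord].
Qed.

Lemma continuous_coordM (k l : 'I_n) : continuous (fun v : 'rV[R]_n => v 0 k * v 0 l).
Proof. by move=> v; apply: continuousM; exact: coord_continuous. Qed.

Lemma sphere_coordM k l : bdd_meas (fun w => V w 0 k * V w 0 l).
Proof. by apply: bdd_measM; exact: sphere_coord. Qed.

(** The reflection [diag_mx s] changes the sign of coordinate [k] alone, hence of the product. *)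
Lemma sphere_cov0 k l : k != l -> Ex P (fun w => V w 0 k * V w 0 l) = 0.
Proof.
move=> kl; pose s : 'rV[R]_n := \row_j (if j == k then -1 else 1).
have QE (v : 'rV[R]_n) j : (v *m diag_mx s) 0 j = (if j == k then -1 else 1) * v 0 j.
  by rewrite mul_mx_diag !mxE mulrC.
have QQ : diag_mx s *m (diag_mx s)^T = 1%:M.
  rewrite tr_diag_mx mulmx_diag -diag_const_mx; congr diag_mx; apply/rowP => j.
  by rewrite !mxE; case: ifP; rewrite ?mulrNN mulr1.
have E w : (V w *m diag_mx s) 0 k * (V w *m diag_mx s) 0 l = -1 * (V w 0 k * V w 0 l).
  by rewrite !QE eqxx eq_sym (negbTE kl); ring.
have := sphere_invariant (@continuous_coordM k l) QQ (sphere_coordM k l).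
under eq_fun do rewrite E.
move=> /(_ (bdd_measZ (-1) (sphere_coordM k l))).
by rewrite ExZ; [lra | exact: sphere_coordM].
Qed.

(** Invariance under the permutation matrix exchanging the two coordinates. *)
Lemma sphere_var_eq k l :
  Ex P (fun w => V w 0 k * V w 0 k) = Ex P (fun w => V w 0 l * V w 0 l).
Proof.
pose Q : 'M[R]_n := perm_mx (tperm k l).
have QQ : Q *m Q^T = 1%:M by rewrite tr_perm_mx -perm_mxM mulgV perm_mx1.
have QE (v : 'rV[R]_n) : (v *m Q) 0 k = v 0 l.
  by rewrite /Q -[tperm k l]invgK -col_permE mxE tpermV tpermL.
have := sphere_invariant (@continuous_coordM k k) QQ (sphere_coordM k k).
under eq_fun do rewrite !QE.
by move=> /(_ (sphere_coordM l l)).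
Qed.

(** The [n] equal second moments add up to the mean of [enorm (V w) ^+ 2], which is 1. *)
Lemma sphere_cov k l :
  Ex P (fun w => V w 0 k * V w 0 l) = (k == l)%:R / n%:R.
Proof.
have [<-|kl] := eqVneq k l; last by rewrite sphere_cov0 // mul0r.
have : Ex P (fun w => \sum_j V w 0 j * V w 0 j) = 1.
  under eq_fun => w.
    rewrite -/(dotv (V w) (V w)) -enorm_sq.
    have -> : enorm (V w) = 1 by case: V_unif.
    rewrite expr1n; over.
  exact: Ex_cst.
rewrite Ex_sum => [|j _]; last exact: sphere_coordM.
under eq_bigr do rewrite (sphere_var_eq _ k).
rewrite sumr_const card_ord; set e := Ex P _ => en.
have h : e * n%:R = 1 by rewrite mulr_natr.
have n0 : n%:R != 0 :> R.
  by apply/eqP => n0; move: h; rewrite n0 mulr0 => /esym/eqP; rewrite oner_eq0.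
by apply: (mulIf n0); rewrite h divfK.
Qed.

End SphereMoments.

Section OnePointEstimate.
Context {R : realType} {dO : measure_display} {Om : measurableType dO}.
Variable P : probability Om R.
Context {I : eqType} {K : set I} {n : nat}.
Variables (V : I -> Om -> 'rV[R]_n) (k0 : I).
Hypotheses (ind : mutually_independent P K (V : I -> Om -> borel_mx R 1 n)) (Kk0 : K k0)
  (V_unif : forall k, K k -> uniform_on_sphere P (V k)).
Local Notation Rest := (rest (K := K) (V : I -> Om -> borel_mx R 1 n) k0).

Let V_meas k : K k -> measurable_fun setT (V k : Om -> borel_mx R 1 n).
Proof. by move=> /V_unif []. Qed.

Lemma rest_bdd (X : Om -> R) : bdd_meas (X : Rest -> R) -> bdd_meas X.
Proof. by move=> [mX bX]; split; [exact: (measurable_of_rest V_meas mX) | exact: bX]. Qed.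

Lemma rest_Ex_mul (X : Om -> R) (phi : 'rV[R]_n -> R) : bdd_meas (X : Rest -> R) ->
  continuous phi -> bdd_meas (fun w => phi (V k0 w)) ->
  Ex P (fun w => X w * phi (V k0 w)) = Ex P X * Ex P (fun w => phi (V k0 w)).
Proof.
move=> bX cphi bphi; apply: Ex_mul_indep => //; first exact: rest_bdd.
move=> A B mA mB.
apply: (rest_independent ind Kk0 V_meas (E := X @^-1` A) (A := phi @^-1` B)).
  by have [mX _] := bX; rewrite -[X in <<s _ >> X]setTI; exact: mX.
by rewrite -[X in measurable X]setTI; exact: continuous_measurable_mx.
Qed.

(** Here [f] is to be the unperturbed cost, [g] the gradient and [h] the deviation from the target.
    Expanding the product leaves finitely many terms, each a factor independent of [V k0] times a
    monomial in [V k0]: those of degree one have mean 0, those of degree two survive only for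
    [k = l]. *)
Lemma one_point_estimate (delta : R) (f : Om -> R) (g h : 'I_n -> Om -> R) :
  bdd_meas (f : Rest -> R) -> (forall k, bdd_meas (g k : Rest -> R)) ->
  (forall k, bdd_meas (h k : Rest -> R)) ->
  Ex P (fun w => (f w + delta * \sum_k g k w * V k0 w 0 k) * \sum_l V k0 w 0 l * h l w)
    = delta / n%:R * Ex P (fun w => \sum_k g k w * h k w).
Proof.
move=> bf bg bh.
have bV l := sphere_coord (V_unif Kk0) l.
have bVV k l := sphere_coordM (V_unif Kk0) k l.
have bfh l : bdd_meas ((fun w => f w * h l w) : Rest -> R) by exact: bdd_measM.
have bgh k l : bdd_meas ((fun w => g k w * h l w) : Rest -> R) by exact: bdd_measM.
have b1 l : bdd_meas (fun w => (f w * h l w) * V k0 w 0 l).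
  by apply: bdd_measM => //; apply: rest_bdd.
have b2 k l : bdd_meas (fun w => delta * ((g k w * h l w) * (V k0 w 0 k * V k0 w 0 l))).
  by apply: bdd_measZ; apply: bdd_measM => //; apply: rest_bdd.
have E w : (f w + delta * \sum_k g k w * V k0 w 0 k) * (\sum_l V k0 w 0 l * h l w)
  = \sum_l (f w * h l w) * V k0 w 0 l
    + \sum_l \sum_k delta * ((g k w * h l w) * (V k0 w 0 k * V k0 w 0 l)).
  rewrite -big_split mulr_sumr; apply: eq_bigr => l _ /=.
  rewrite mulrDl; congr (_ + _); first by ring.
  by rewrite mulr_sumr mulr_suml; apply: eq_bigr => k _; ring.
under eq_fun do rewrite E.
rewrite ExD; last 2 first.
- by apply: bdd_meas_sum => l _; exact: b1.
- by apply: bdd_meas_sum => l _; apply: bdd_meas_sum => k _; exact: b2.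
rewrite Ex_sum => [|l _]; last exact: b1.
rewrite big1 ?add0r => [|l _]; last first.
  rewrite (rest_Ex_mul (phi := fun v => v 0 l)) ?(sphere_mean (V_unif Kk0)) ?mulr0 //.
  exact: coord_continuous.
rewrite Ex_sum => [|l _]; last by apply: bdd_meas_sum => k _; exact: b2.
rewrite Ex_sum => [|l _]; last exact: rest_bdd.
rewrite mulr_sumr; apply: eq_bigr => l _.
rewrite Ex_sum => [|k _]; last exact: b2.
have E2 k : Ex P (fun w => delta * ((g k w * h l w) * (V k0 w 0 k * V k0 w 0 l)))
   = delta * (Ex P (fun w => g k w * h l w) * ((k == l)%:R / n%:R)).
  rewrite ExZ; last by apply: bdd_measM => //; apply: rest_bdd.
  rewrite (rest_Ex_mul (phi := fun v => v 0 k * v 0 l)) ?(sphere_cov (V_unif Kk0)) //.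
  exact: continuous_coordM.
under eq_bigr do rewrite E2.
rewrite (bigD1 l) //= big1 ?addr0 => [|k /negbTE kl]; last by rewrite kl !(mul0r, mulr0).
by rewrite eqxx mul1r -mulrA (mulrC n%:R^-1).
Qed.

End OnePointEstimate.

(** * Finite-difference gradients *)

Section FiniteDifference.
Context {R : realType} {N n : nat}.
Variables (rho D U delta : R) (mu r : 'I_N -> R) (L : 'I_N -> 'I_N -> R).
Variables (X : 'I_N -> set 'rV[R]_n) (C : 'I_N -> 'M[R]_(N, n) -> R).
Hypotheses (n_gt0 : (0 < n)%N) (rho_gt0 : 0 < rho) (D_gt0 : 0 < D)
  (delta_gt0 : 0 < delta) (delta_lt : delta < rho)
  (mu_gt0 : forall i, 0 < mu i) (r_gt0 : forall i, 0 < r i).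
Hypotheses (X_convex : forall i, convex_set (X i))
  (X_ball : forall i v, enorm v <= rho -> X i v)
  (X_diam : forall i v w, X i v -> X i w -> enorm (v - w) <= D)
  (C_diff : forall i x, profiles X x -> differentiable_own X C i x)
  (C_sc : forall i x, profiles X x -> strongly_convex (mu i) (X i) (own_cost C i x))
  (C_lip : forall i j x y, profiles X x -> profiles X y ->
     (forall k, k != j -> row k x = row k y) ->
     enorm (own_gradient X C i x - own_gradient X C i y)
       <= L i j * enorm (row j x - row j y))
  (C_grad : forall i x, profiles X x -> enorm (own_gradient X C i x) <= U).
Implicit Types (z x : 'M[R]_(N, n)) (i j : 'I_N) (k : 'I_n) (v p : 'rV[R]_n).

Definition shifted z i k : 'M[R]_(N, n) := deviate z i (row i z + delta *: delta_mx 0 k).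

(* A measurable stand-in for the gradient, computed from finitely many costs. *)
Definition fd_gradient z i k : R := (C i (shifted z i k) - C i z) / delta.

Let L_ge0 i j : 0 <= L i j. Proof. exact: (lipschitz_ge0 n_gt0 rho_gt0 X_ball C_lip). Qed.

Let taylor i z v : profiles X z -> X i v ->
  `|C i (deviate z i v) - C i z - dotv (own_gradient X C i z) (v - row i z)|
    <= L i i * enorm (v - row i z) ^+ 2.
Proof. exact: (cost_taylor n_gt0 rho_gt0 mu_gt0 X_convex X_ball C_diff C_sc C_lip). Qed.

Lemma enorm_delta_mx k : enorm (delta_mx 0 k : 'rV[R]_n) = 1.
Proof.
rewrite /enorm /dotv (bigD1 k) //= !mxE !eqxx big1 => [|j /negbTE jk].
  by rewrite mulr1 addr0 sqrtr1.
by rewrite !mxE jk andbF mulr0.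
Qed.

Lemma dotv_delta_mx v k : dotv v (delta_mx 0 k) = v 0 k.
Proof.
rewrite /dotv (bigD1 k) //= !mxE !eqxx big1 => [|j /negbTE jk].
  by rewrite mulr1 addr0.
by rewrite !mxE jk andbF mulr0.
Qed.

Let probe i z w : profiles X z -> shrink (X i) rho delta (row i z) -> enorm w <= 1 ->
  X i (row i z + delta *: w).
Proof.
by move=> Xz sz; apply: (shrink_add rho_gt0 (ltW delta_gt0) delta_lt (@X_convex i) (@X_ball i)).
Qed.

Lemma shifted_profiles i z k : profiles X z -> shrink (X i) rho delta (row i z) ->
  profiles X (shifted z i k).
Proof.
by move=> Xz sz; apply: deviate_profiles => //; apply: probe; rewrite ?enorm_delta_mx.
Qed.

(** The Taylor bound along the axis [k], divided by [delta]. *)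
Lemma fd_gradient_error i z k : profiles X z -> shrink (X i) rho delta (row i z) ->
  `|fd_gradient z i k - own_gradient X C i z 0 k| <= L i i * delta.
Proof.
move=> Xz sz; have Xp : X i (row i z + delta *: delta_mx 0 k).
  by apply: probe; rewrite ?enorm_delta_mx.
have := taylor Xz Xp.
rewrite [row i z + _ - _]addrC addKr dotvZr dotv_delta_mx enormZ enorm_delta_mx.
rewrite mulr1 (gtr0_norm delta_gt0).
set g := own_gradient X C i z 0 k => h.
rewrite -(ler_pM2l delta_gt0) -{1}(gtr0_norm delta_gt0) -normrM.
rewrite /fd_gradient /shifted mulrBr mulrCA divff ?gt_eqF // mulr1.
by apply: le_trans h _; rewrite expr2 mulrCA.
Qed.

(** The Taylor remainder gives the 1; replacing the gradient by difference quotients in [n]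
    coordinates, inside a term multiplied by [delta], gives the [n]. *)
Lemma played_cost_error i z w : profiles X z -> shrink (X i) rho delta (row i z) ->
  enorm w = 1 ->
  `|C i (deviate z i (row i z + delta *: w))
      - (C i z + delta * \sum_k fd_gradient z i k * w 0 k)|
    <= (1 + n%:R) * L i i * delta ^+ 2.
Proof.
move=> Xz sz w1; have Xp : X i (row i z + delta *: w) by apply: probe; rewrite ?w1.
have := taylor Xz Xp.
rewrite [row i z + _ - _]addrC addKr dotvZr enormZ w1 mulr1 (gtr0_norm delta_gt0).
set g := own_gradient X C i z; set c := C i (deviate _ _ _) => h.
have h2 : `|dotv g w - \sum_k fd_gradient z i k * w 0 k| <= n%:R * (L i i * delta).
  rewrite /dotv -sumrB; apply: le_trans (ler_norm_sum _ _ _) _.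
  apply: (@le_trans _ _ (\sum_(k < n) L i i * delta)); last first.
    by rewrite sumr_const card_ord mulr_natl.
  apply: ler_sum => k _; rewrite -mulrBl normrM distrC.
  rewrite -[leRHS]mulr1; apply: ler_pM => //; first exact: fd_gradient_error.
  by rewrite -w1 coord_le_enorm.
have -> : c - (C i z + delta * \sum_k fd_gradient z i k * w 0 k) =
   (c - C i z - delta * dotv g w) + delta * (dotv g w - \sum_k fd_gradient z i k * w 0 k).
  by ring.
apply: le_trans (ler_normD _ _) _; rewrite normrM (gtr0_norm delta_gt0).
have h3 := ler_wpM2l (ltW delta_gt0) h2.
apply: le_trans (lerD h h3) _.
by rewrite le_eqVlt; apply/orP; left; apply/eqP; ring.
Qed.

Variable xs : 'M[R]_(N, n).
Hypothesis xs_nash : is_nash X C xs.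

(** The equilibrium action may lie outside the shrunken set onto which the algorithm projects; this
    nearby point lies inside it. *)
Definition target i : 'rV[R]_n := (1 - delta / rho) *: row i xs.

Lemma target_shrink i : shrink (X i) rho delta (target i).
Proof.
apply: (shrink_scale rho_gt0 (ltW delta_gt0) delta_lt (@X_convex i) (@X_ball i)).
exact: xs_nash.1.
Qed.

Lemma target_in i : X i (target i). Proof. by have [] := target_shrink i. Qed.

Lemma target_dist i : enorm (target i - row i xs) <= delta / rho * D.
Proof.
have -> : target i - row i xs = - (delta / rho) *: row i xs.
  by rewrite /target scalerBl scale1r addrAC subrr add0r scaleNr.
have dr0 : 0 <= delta / rho by rewrite divr_ge0 // ltW.
rewrite enormZ normrN ger0_norm // ler_wpM2l //.
have := X_diam (xs_nash.1 i) (X_ball i (v := 0) _); rewrite subr0; apply.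
by rewrite enorm0 ltW.
Qed.

(* How far the expected update direction may fall short of strong monotonicity
   when every played action lags behind by at most [lag]. *)
Definition drift_error (lag : R) i : R :=
  n%:R * L i i * delta * D + U * (delta / rho * D)
  + (L i i * (delta / rho * D)
     + \sum_(j < N | j != i) L i j * (lag + delta / rho * D)) * D.

(** [z] is the profile where the costs are evaluated and [x] the current iterates: they agree in row
    [i], and in the other rows up to [lag]. The bound is quadratic in the current distances, so its
    expectation involves only mean square distances. *)
Lemma fd_gradient_monotone (lag : R) i z x : profiles X z ->
  shrink (X i) rho delta (row i z) ->
  profiles X x -> row i z = row i x ->
  (forall j, enorm (row j z - row j x) <= lag) ->
  mu i * enorm (row i x - target i) ^+ 2
    - \sum_(j < N | j != i) L i j *
       ((r j / r i * enorm (row i x - target i) ^+ 2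
         + r i / r j * enorm (row j x - target j) ^+ 2) / 2)
    - drift_error lag i
  <= \sum_k fd_gradient z i k * (row i x - target i) 0 k.
Proof.
move=> Xz sz Xx zx hlag.
have h := nash_monotone mu_gt0 X_convex C_diff C_sc C_lip C_grad xs_nash Xz (target_in i).
rewrite zx in h; set y := row i x - target i in h *.
set kap := delta / rho * D in h *.
have kap0 : 0 <= kap by rewrite mulr_ge0 ?divr_ge0 // ltW.
have yD : enorm y <= D by apply: X_diam; [exact: Xx | exact: target_in].
have y0 := enorm_ge0 y.
have U0 : 0 <= U by apply: le_trans (enorm_ge0 _) (C_grad i Xz).
have h1 : dotv (own_gradient X C i z) y - n%:R * L i i * delta * D
    <= \sum_k fd_gradient z i k * y 0 k.
  rewrite lerBlDr -lerBlDl /dotv -sumrB.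
  apply: (@le_trans _ _ (\sum_(k < n) L i i * delta * D)); last first.
    by rewrite sumr_const card_ord -mulr_natl le_eqVlt; apply/orP; left; apply/eqP; ring.
  apply: ler_sum => k _; rewrite -mulrBl (le_trans (ler_norm _)) // normrM distrC.
  apply: ler_pM => //; first exact: fd_gradient_error.
  exact: le_trans (coord_le_enorm _ _) yD.
have h2 : U * enorm (target i - row i xs) <= U * kap by rewrite ler_wpM2l // target_dist.
have h3 : L i i * enorm (target i - row i xs) * enorm y <= L i i * kap * D.
  by rewrite ler_pM // ?mulr_ge0 ?enorm_ge0 // ler_wpM2l // target_dist.
have h4 : (\sum_(j < N | j != i) L i j * enorm (row j z - row j xs)) * enorm y <=
   \sum_(j < N | j != i) L i j *
       ((r j / r i * enorm y ^+ 2 + r i / r j * enorm (row j x - target j) ^+ 2) / 2)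
   + (\sum_(j < N | j != i) L i j * (lag + kap)) * D.
  rewrite !mulr_suml -big_split; apply: ler_sum => j _ /=.
  rewrite -!mulrA -mulrDr ler_wpM2l //.
  set b := enorm (row j x - target j).
  have b0 : 0 <= b by exact: enorm_ge0.
  have zj : enorm (row j z - row j xs) <= (lag + kap) + b.
    apply: le_trans (enorm_triangle (row j x) _ _) _.
    rewrite -addrA lerD // addrC.
    by apply: le_trans (enorm_triangle (target j) _ _) _; rewrite lerD // target_dist.
  have lk0 : 0 <= lag + kap.
    by rewrite addr_ge0 // (le_trans (enorm_ge0 _) (hlag i)).
  have e1 := ler_wpM2r y0 zj.
  have e2 := ler_wpM2l lk0 yD.
  (* AM-GM with weights [r j / r i] *)
  have e3 : b * enorm y <= (r j / r i * enorm y ^+ 2 + r i / r j * b ^+ 2) / 2.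
    have ri := r_gt0 i; have rj := r_gt0 j.
    have rr : 0 < r i / r j by rewrite divr_gt0.
    have -> : r j / r i = (r i / r j)^-1 by rewrite invf_div.
    set a := r i / r j in rr *.
    rewrite -subr_ge0 (_ : _ - _ = (a * b - enorm y) ^+ 2 / (2 * a)).
      by rewrite divr_ge0 ?sqr_ge0 // mulr_ge0 // ltW.
    by field; rewrite gt_eqF.
  lra.
rewrite /drift_error -/kap mulrDl; rewrite mulrDl in h; lra.
Qed.

End FiniteDifference.

(** * One expected update *)

Section ExpectedUpdate.
Context {R : realType} {N n : nat}.
Variables (rho D U Uc eta delta : R) (B : nat).
Variables (mu r : 'I_N -> R) (L : 'I_N -> 'I_N -> R).
Variables (X : 'I_N -> set 'rV[R]_n) (C : 'I_N -> 'M[R]_(N, n) -> R).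
Hypotheses (n_gt0 : (0 < n)%N) (rho_gt0 : 0 < rho) (D_gt0 : 0 < D)
  (delta_gt0 : 0 < delta) (delta_lt : delta < rho) (eta_ge0 : 0 <= eta)
  (mu_gt0 : forall i, 0 < mu i) (r_gt0 : forall i, 0 < r i).
Hypotheses (X_closed : forall i, closed (X i)) (X_convex : forall i, convex_set (X i))
  (X_ball : forall i v, enorm v <= rho -> X i v)
  (X_diam : forall i v w, X i v -> X i w -> enorm (v - w) <= D)
  (C_meas : forall i, measurable_fun (profiles X : set (borel_mx R N n)) (C i))
  (C_diff : forall i x, profiles X x -> differentiable_own X C i x)
  (C_sc : forall i x, profiles X x -> strongly_convex (mu i) (X i) (own_cost C i x))
  (C_lip : forall i j x y, profiles X x -> profiles X y ->
     (forall k, k != j -> row k x = row k y) ->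
     enorm (own_gradient X C i x - own_gradient X C i y)
       <= L i j * enorm (row j x - row j y))
  (C_grad : forall i x, profiles X x -> enorm (own_gradient X C i x) <= U)
  (C_bound : forall i x, profiles X x -> `|C i x| <= Uc).
Variable xs : 'M[R]_(N, n).
Hypothesis xs_nash : is_nash X C xs.
Variables (Tup : 'I_N -> set nat) (x1 xh0 : 'M[R]_(N, n)).
Hypotheses (Tup_async : forall i t, (1 <= t)%N -> exists2 s, Tup i s & (t <= s < t + B)%N)
  (Tup_gt0 : forall i, Tup i `<=` [set t | (1 <= t)%N])
  (x1P : forall i, shrink (X i) rho delta (row i x1)) (xh0P : profiles X xh0).
Context {dO : measure_display} {Om : measurableType dO}.
Variables (P : probability Om R) (u : 'I_N -> nat -> Om -> 'rV[R]_n).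
Hypotheses (u_unif : forall i t, Tup i t -> uniform_on_sphere P (u i t))
  (u_ind : mutually_independent P [set k : 'I_N * nat | Tup k.1 k.2]
    (fun k => u k.1 k.2 : Om -> borel_mx R 1 n)).
Variables (x xh : Om -> nat -> 'M[R]_(N, n)).
Hypothesis run : forall w, zo_run X C rho eta delta Tup x1 xh0 (fun i t => u i t w) (x w) (xh w).

Local Notation p := (target rho delta xs).
Local Notation step := (step_bound (n := n) Uc eta delta).
Local Notation V := (fun k : 'I_N * nat => u k.1 k.2).
Local Notation Rest i t :=
  (rest (K := [set k : 'I_N * nat | Tup k.1 k.2]) (V : _ -> Om -> borel_mx R 1 n) (i, t)).

Definition msd i t : R := Ex P (fun w => enorm (row i (x w t) - p i) ^+ 2).

Let u1 w i t : Tup i t -> enorm (u i t w) = 1.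
Proof. by move=> /u_unif [_ h _]; exact: h. Qed.

Let xP w i t : (1 <= t)%N -> shrink (X i) rho delta (row i (x w t)).
Proof. exact: (run_shrink rho_gt0 X_closed X_ball Tup_gt0 x1P (run w)). Qed.

Let xhP w t : profiles X (xh w t).
Proof.
exact: (run_profiles rho_gt0 delta_gt0 delta_lt X_closed X_convex X_ball Tup_gt0 x1P xh0P
  (u1 w) (run w)).
Qed.

Let xX w i t : (1 <= t)%N -> X i (row i (x w t)).
Proof. by move=> t1; have [] := xP w i t1. Qed.

Let pP i : shrink (X i) rho delta (p i).
Proof. exact: (target_shrink rho_gt0 delta_gt0 delta_lt X_convex X_ball xs_nash). Qed.

Lemma dist_le w i t : (1 <= t)%N -> enorm (row i (x w t) - p i) <= D.
Proof. by move=> t1; apply: X_diam; [exact: xX | have [] := pP i]. Qed.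

Lemma row_measurable i t : (1 <= t)%N -> measurable_rv (fun w => row i (x w t)).
Proof.
move=> t1; apply: (measurable_run X_closed C_meas rho_gt0 X_convex X_ball run xhP _ t1 i).1.
by move=> j s _ js; exact: sphere_measurable (u_unif js).
Qed.

Lemma sqdist_bdd i t v : (1 <= t)%N -> bdd_meas (fun w => enorm (row i (x w t) - v) ^+ 2).
Proof.
move=> t1; split.
  under eq_fun do rewrite expr2.
  have mv : measurable_fun setT (fun w => enorm (row i (x w t) - v)).
    apply: measurable_enorm.
    by apply: measurable_rvB; [exact: row_measurable | exact: measurable_rv_cst].
  exact: measurable_funM.
exists ((D + enorm (p i - v)) ^+ 2) => w.
have D0 := ltW D_gt0.
rewrite ger0_norm ?sqr_ge0 // ler_pXn2r ?nnegrE ?addr_ge0 ?enorm_ge0 //.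
by apply: le_trans (enorm_triangle (p i) _ _) _; rewrite lerD2r dist_le.
Qed.

Lemma msd_le i t : (1 <= t)%N -> msd i t <= D ^+ 2.
Proof.
move=> t1; rewrite -[leRHS](Ex_cst P); apply: Ex_le.
- exact: sqdist_bdd.
- exact: bdd_meas_cst.
by move=> w; rewrite ler_pXn2r ?nnegrE ?enorm_ge0 ?dist_le // ltW.
Qed.

Lemma msd_idle i t : (1 <= t)%N -> ~ Tup i t -> msd i t.+1 = msd i t.
Proof.
move=> t1 it; rewrite /msd; congr (Ex P _); apply/funext => w.
by rewrite (run_idle (run w)).
Qed.

Section Update.
Variables (i : 'I_N) (t : nat).
Hypotheses (it : Tup i t) (Bt : (B <= t)%N).

Let t1 : (1 <= t)%N. Proof. exact: Tup_gt0 it. Qed.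

(* The profile seen by the gradient estimate of agent i, without its own perturbation. *)
Let Z w := deviate (xh w t) i (row i (x w t)).

Let ZP w : profiles X (Z w). Proof. by apply: deviate_profiles; [exact: xhP | exact: xX]. Qed.

Let Zi w : row i (Z w) = row i (x w t). Proof. by rewrite row_deviate eqxx. Qed.

Let Zs w : shrink (X i) rho delta (row i (Z w)). Proof. by rewrite Zi; exact: xP. Qed.

Let fd w k := fd_gradient delta C (Z w) i k.

Let xhE w : xh w t = deviate (Z w) i (row i (Z w) + delta *: u i t w).
Proof.
rewrite Zi /Z deviate_deviate -(run_played Tup_gt0 (run w) it) deviate_row //.
Qed.

Let rest_u (j : 'I_N) (s : nat) : Tup j s -> (j, s) != (i, t) ->
  measurable_rv (u j s : Rest i t -> 'rV[R]_n).
Proof.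
move=> js ne; apply: borel_rv_coord.
exact: (@rest_measurable _ _ _ [set k : 'I_N * nat | Tup k.1 k.2] _ _
   (V : _ -> Om -> borel_mx R 1 n) (i, t) (j, s) js ne).
Qed.

Let rest_run (j : 'I_N) : measurable_rv ((fun w => row j (x w t)) : Rest i t -> _) /\
  measurable_rv ((fun w => row j (xh w t.-1)) : Rest i t -> _).
Proof.
apply: (@measurable_run _ _ _ _ (Rest i t) _ _ X_closed C_meas _ _ _ rho_gt0 X_convex X_ball
  Tup x1 xh0 u x xh run xhP t _ t1 j).
move=> k s st ks; apply: rest_u => //.
by rewrite xpair_eqE negb_and (ltn_eqF st) orbT.
Qed.

(** Other agents may update at time [t] too, so row [j] of [Z] can involve [u j t]; this is still a
    direction with index other than [(i, t)]. *)
Let rest_Z (j : 'I_N) : measurable_rv ((fun w => row j (Z w)) : Rest i t -> _).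
Proof.
have [->|ji] := eqVneq j i.
  have -> : (fun w => row i (Z w)) = (fun w => row i (x w t)) by apply/funext.
  exact: (rest_run i).1.
have -> : (fun w => row j (Z w)) = (fun w => row j (xh w t)).
  by apply/funext => w; rewrite row_deviate (negbTE ji).
apply: (@measurable_played _ _ _ _ (Rest i t) _ _ _ _ _ _ _ _ _ _ _ run j t t1).
- by move=> jt; apply: rest_u => //; rewrite xpair_eqE negb_and ji.
- exact: (rest_run j).1.
- exact: (rest_run j).2.
Qed.

Let rest_cost : bdd_meas ((fun w => C i (Z w)) : Rest i t -> R).
Proof.
split; first by apply: (measurable_cost X_closed C_meas) => //; exact: rest_Z.
by exists Uc => w; exact: C_bound.
Qed.

Let rest_fd k : bdd_meas ((fun w => fd w k) : Rest i t -> R).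
Proof.
have shP w : profiles X (shifted delta (Z w) i k).
  exact: (shifted_profiles rho_gt0 delta_gt0 delta_lt X_convex X_ball).
have -> : (fun w => fd w k) =
    (fun w => delta^-1 * (C i (shifted delta (Z w) i k) - C i (Z w))).
  by apply/funext => w; rewrite /fd /fd_gradient mulrC.
apply: bdd_measZ; apply: bdd_measB; last exact: rest_cost.
split; last by exists Uc => w; exact: C_bound.
apply: (measurable_cost X_closed C_meas) => // j.
have [->|ji] := eqVneq j i; last first.
  have -> : (fun w => row j (shifted delta (Z w) i k)) = (fun w => row j (Z w)).
    by apply/funext => w; rewrite row_deviate (negbTE ji).
  exact: rest_Z.
have -> : (fun w => row i (shifted delta (Z w) i k)) =
    (fun w => row i (Z w) + delta *: delta_mx 0 k).
  by apply/funext => w; rewrite row_deviate eqxx.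
by apply: measurable_rvD; [exact: rest_Z | exact: measurable_rv_cst].
Qed.

Let rest_dev k : bdd_meas ((fun w => (row i (x w t) - p i) 0 k) : Rest i t -> R).
Proof.
split; first by apply: measurable_rvB; [exact: (rest_run i).1 | exact: measurable_rv_cst].
by exists D => w; apply: le_trans (coord_le_enorm _ _) (dist_le _ _ _).
Qed.

Let nd_ge0 : 0 <= n%:R / delta. Proof. by rewrite divr_ge0 // ltW. Qed.

(** In the pathwise contraction the played cost is replaced by its linear model in [u i t]. The mean
    of the resulting [f] is known exactly, its factor [delta / n] cancels the [n / delta] of the
    estimate, and the monotonicity bound is then integrated. *)
Lemma msd_update : msd i t.+1 <= msd i t
  - 2 * eta * (mu i * msd i t
     - \sum_(j < N | j != i) L i j * ((r j / r i * msd i t + r i / r j * msd j t) / 2)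
     - drift_error (n := n) rho D U delta L (delta + step) i
     - n%:R * (1 + n%:R) * L i i * delta * D) + step ^+ 2.
Proof.
pose s w := \sum_k u i t w 0 k * (row i (x w t) - p i) 0 k.
pose f w := (C i (Z w) + delta * \sum_k fd w k * u i t w 0 k) * s w.
pose m w := \sum_k fd w k * (row i (x w t) - p i) 0 k.
have Kit : [set k : 'I_N * nat | Tup k.1 k.2] (i, t) by [].
have V_unif k : [set k : 'I_N * nat | Tup k.1 k.2] k -> uniform_on_sphere P (V k).
  by move=> Kk; exact: u_unif.
have toOm Y : bdd_meas (Y : Rest i t -> R) -> bdd_meas (Y : Om -> R).
  exact: (rest_bdd V_unif).
have Ef : Ex P f = delta / n%:R * Ex P m.
  exact: (one_point_estimate u_ind Kit V_unif delta rest_cost rest_fd rest_dev).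
have bu k : bdd_meas (fun w => u i t w 0 k) by exact: sphere_coord (u_unif it) k.
have bs : bdd_meas s.
  by apply: bdd_meas_sum => k _; apply: bdd_measM => //; apply: toOm; exact: rest_dev.
have bf : bdd_meas f.
  apply: bdd_measM => //; apply: bdd_measD; first by apply: toOm; exact: rest_cost.
  apply: bdd_measZ; apply: bdd_meas_sum => k _; apply: bdd_measM => //.
  by apply: toOm; exact: rest_fd.
have bm : bdd_meas m.
  apply: bdd_meas_sum => k _; apply: bdd_measM; apply: toOm; [exact: rest_fd | exact: rest_dev].
have ba j : bdd_meas (fun w => enorm (row j (x w t) - p j) ^+ 2) by exact: sqdist_bdd.
(* Error of the linear model times the bound [D] on the inner product [s], whose first factor is a
   unit vector. *)
set e1 := (1 + n%:R) * L i i * delta ^+ 2 * D.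
have L0 : 0 <= L i i by exact: (lipschitz_ge0 n_gt0 rho_gt0 X_ball C_lip).
have low w : f w - e1 <= C i (xh w t) * s w.
  have := played_cost_error n_gt0 rho_gt0 delta_gt0 delta_lt mu_gt0 X_convex X_ball C_diff
    C_sc C_lip (ZP w) (Zs w) (u1 w it).
  rewrite -xhE distrC => h.
  have sD : `|s w| <= D.
    rewrite -/(dotv (u i t w) _) (le_trans (normr_dotv_le _ _)) // u1 // mul1r.
    exact: dist_le.
  rewrite lerBlDr -lerBlDl -mulrBl (le_trans (ler_norm _)) // normrM.
  exact: ler_pM.
have step1 w : enorm (row i (x w t.+1) - p i) ^+ 2 <=
    (enorm (row i (x w t) - p i) ^+ 2 - (2 * eta * (n%:R / delta)) * f w)
    + (2 * eta * (n%:R / delta) * e1 + step ^+ 2).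
  apply: le_trans (run_contraction rho_gt0 delta_gt0 delta_lt eta_ge0 X_closed X_convex X_ball
    C_bound Tup_gt0 x1P xh0P (u1 w) (run w) it (pP i)) _.
  have c0 : 0 <= 2 * eta * (n%:R / delta) by apply: mulr_ge0 => //; apply: mulr_ge0.
  have := ler_wpM2l c0 (low w).
  change (dotv (u i t w) (row i (x w t) - p i)) with (s w); lra.
have h1 : msd i t.+1 <= msd i t - 2 * eta * Ex P m + (2 * eta * (n%:R / delta) * e1 + step ^+ 2).
  have := Ex_le P (sqdist_bdd i (p i) (isT : (1 <= t.+1)%N))
    (bdd_measD (bdd_measB (ba i) (bdd_measZ _ bf)) (bdd_meas_cst _)) step1.
  rewrite ExD; [|by apply: bdd_measB => //; exact: bdd_measZ|exact: bdd_meas_cst].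
  rewrite ExB; [|by []|exact: bdd_measZ].
  rewrite ExZ // Ef Ex_cst -/(msd i t) -/(msd i t.+1).
  rewrite (_ : 2 * eta * (n%:R / delta) * (delta / n%:R * Ex P m) = 2 * eta * Ex P m) //.
  have n0 : n%:R != 0 :> R by rewrite pnatr_eq0 -lt0n.
  by have d0 := lt0r_neq0 delta_gt0; field; rewrite ?n0 ?d0.
pose q w := (mu i * enorm (row i (x w t) - p i) ^+ 2
    - \sum_(j < N | j != i) L i j * 2^-1 *
       (r j / r i * enorm (row i (x w t) - p i) ^+ 2
         + r i / r j * enorm (row j (x w t) - p j) ^+ 2))
    - drift_error (n := n) rho D U delta L (delta + step) i.
have bq j : bdd_meas (fun w => L i j * 2^-1 * (r j / r i * enorm (row i (x w t) - p i) ^+ 2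
         + r i / r j * enorm (row j (x w t) - p j) ^+ 2)).
  by apply: bdd_measZ; apply: bdd_measD; apply: bdd_measZ.
have h2 : Ex P q <= Ex P m.
  apply: Ex_le => //.
    apply: bdd_measB; last exact: bdd_meas_cst.
    by apply: bdd_measB; [exact: bdd_measZ | apply: bdd_meas_sum => j _; exact: bq].
  move=> w; apply: le_trans (fd_gradient_monotone n_gt0 rho_gt0 D_gt0 delta_gt0 delta_lt mu_gt0
    r_gt0 X_convex X_ball X_diam C_diff C_sc C_lip C_grad xs_nash (ZP w) (Zs w)
    (fun j => xX w j t1) (Zi w) (lag := delta + step) _).
    rewrite /q le_eqVlt; apply/orP; left; apply/eqP; congr (_ - _ - _).
    by apply: eq_bigr => j _; rewrite -mulrA (mulrC _ 2^-1).
  move=> j; rewrite row_deviate; have [->|_] := eqVneq j i.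
    rewrite subrr enorm0; apply: addr_ge0; first exact: ltW.
    exact: (step_bound_ge0 delta_gt0 eta_ge0 C_bound xh0P i).
  exact: (run_lag rho_gt0 delta_gt0 delta_lt eta_ge0 X_closed X_convex X_ball C_bound
    Tup_async Tup_gt0 x1P xh0P (u1 w) (run w)).
have h3 : Ex P q = mu i * msd i t
     - \sum_(j < N | j != i) L i j * ((r j / r i * msd i t + r i / r j * msd j t) / 2)
     - drift_error (n := n) rho D U delta L (delta + step) i.
  rewrite /q ExB; last 2 first.
  - by apply: bdd_measB; [exact: bdd_measZ | apply: bdd_meas_sum => j _; exact: bq].
  - exact: bdd_meas_cst.
  rewrite Ex_cst ExB; [|exact: bdd_measZ|by apply: bdd_meas_sum => j _; exact: bq].
  rewrite ExZ // Ex_sum => [|j _]; last exact: bq.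
  congr (_ - _ - _); apply: eq_bigr => j _.
  rewrite ExZ; last by apply: bdd_measD; apply: bdd_measZ.
  rewrite ExD; [|exact: bdd_measZ|exact: bdd_measZ].
  by rewrite !ExZ // -mulrA (mulrC 2^-1).
have h4 := ler_wpM2l (mulr_ge0 (ler0n R 2) eta_ge0) h2.
rewrite h3 in h4.
have e1E : 2 * eta * (n%:R / delta) * e1 = 2 * eta * (n%:R * (1 + n%:R) * L i i * delta * D).
  by rewrite /e1; field; rewrite gt_eqF.
rewrite e1E in h1; apply: le_trans h1 _; lra.
Qed.

End Update.

End ExpectedUpdate.

(** * Rates *)

Section WindowContraction.
Context {R : realFieldType} {N : nat}.
Variables (b : 'I_N -> nat -> R) (Tup : 'I_N -> set nat) (B : nat) (q W Z : R).
Hypotheses (B_gt0 : (0 < B)%N) (q_ge0 : 0 <= q) (Z_ge0 : 0 <= Z).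
Hypothesis Tup_async : forall i t, (1 <= t)%N -> exists2 s, Tup i s & (t <= s < t + B)%N.
Hypothesis b_idle : forall i t, (B <= t)%N -> ~ Tup i t -> b i t.+1 = b i t.
Hypothesis b_update : forall i t V, (B <= t)%N -> Tup i t -> 0 <= V ->
  (forall j, b j t <= W + V) -> b i t.+1 <= W + q * V.
Hypothesis b_bound : forall i t, (B <= t)%N -> b i t <= W + Z.

(** From time [B + k * B] on, all agents satisfy the bound of level [k]. An agent reaches level
    [k + 1] at its first update in the next window and keeps it: idling changes nothing, and a later
    update again starts from values that are at level [k] for everybody. *)
Lemma window_contraction k i t : (B + k * B <= t)%N -> b i t <= W + q ^+ k * Z.
Proof.
elim: k i t => [|k IH] i t; first by rewrite mul0n addn0 expr0 mul1r; exact: b_bound.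
have kB : (B <= B + k * B)%N by rewrite leq_addr.
have [s is_ /andP[ks sk]] := Tup_async i (leq_trans B_gt0 kB).
rewrite mulSn addnC => /(leq_trans sk).
elim: t => // t IHt; rewrite ltnS => st.
have kt := leq_trans ks st; have Bt := leq_trans kB kt.
have [it|it] := pselect (Tup i t).
  rewrite exprS -mulrA; apply: b_update => // [|j]; last exact: IH.
  by rewrite mulr_ge0 // exprn_ge0.
rewrite b_idle //; apply: IHt; rewrite ltn_neqAle st andbT.
by apply/eqP => e; apply: it; rewrite -e.
Qed.

End WindowContraction.

Section Rates.
Context {R : realType}.
Variables (B T : nat).
Hypotheses (B_gt0 : (1 <= B)%N) (BT : (2 * B <= T)%N).
Local Notation y := (T%:R `^ (1 / 3) : R).
Local Notation l := (ln (T%:R / B%:R) : R).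
Local Notation Th := (B%:R ^+ 2 * l / y).

Let B1 : 1 <= B%:R :> R. Proof. by rewrite ler1n. Qed.
Let B0 : 0 < B%:R :> R. Proof. exact: lt_le_trans ltr01 B1. Qed.
Let TB : 2 * B%:R <= T%:R :> R. Proof. by rewrite -natrM ler_nat. Qed.
Let T1 : 1 <= T%:R :> R. Proof. by have := B1; have := TB; lra. Qed.
Let T0 : 0 < T%:R :> R. Proof. exact: lt_le_trans ltr01 T1. Qed.

Lemma cbrt_ge1 : 1 <= y.
Proof.
have h : 1 `^ (1 / 3) = 1 :> R by rewrite powR1.
rewrite -[leLHS]h; apply: ge0_ler_powR; rewrite ?nnegrE //.
Qed.

Let y0 : 0 < y. Proof. exact: lt_le_trans ltr01 cbrt_ge1. Qed.

Lemma cbrt_cube : y ^+ 3 = T%:R.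
Proof. by rewrite -powR_mulrn ?powR_ge0 // -powRrM div1r mulVf // powRr1 // ltW. Qed.

(** From [exp (- 1/2) >= 1 - 1/2] one gets [exp (1/2) <= 2 <= T / B]. *)
Lemma log_ratio_ge : 1 / 2 <= l.
Proof.
have tau : 2 <= T%:R / B%:R :> R by rewrite ler_pdivlMr.
rewrite -ler_expR lnK ?posrE ?divr_gt0 //; apply: le_trans tau.
have := @expR_ge1Dx R (- (1 / 2)); rewrite expRN => h.
rewrite -[leRHS]invrK -[leLHS]invrK lef_pV2 ?posrE ?invr_gt0 ?expR_gt0 //.
by apply: le_trans h; lra.
Qed.

Let l0 : 0 < l. Proof. by have := log_ratio_ge; lra. Qed.

Lemma rate_gt0 : 0 < Th.
Proof. by rewrite divr_gt0 // mulr_gt0 // exprn_gt0. Qed.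

Lemma perturbation_le_rate : B%:R / y <= 2 * Th.
Proof.
rewrite mulrA ler_pM2r ?invr_gt0 // -[leLHS]mulr1 expr2 -mulrA mulrCA ler_pM2l //.
by have := log_ratio_ge; have := B1; nra.
Qed.

Lemma log_step_le_rate : B%:R * l / T%:R <= Th.
Proof.
have yT := cbrt_cube; have y1 := cbrt_ge1; have lp := ltW l0.
rewrite ler_pdivrMr //; move: y0 yT y1 lp; set z := y; set a := l => z0 zT z1 a0.
rewrite -zT (_ : _ / z * z ^+ 3 = (B%:R * a) * (B%:R * z ^+ 2)); last first.
  by field; rewrite gt_eqF.
rewrite ler_peMr ?mulr_ge0 //.
have h1 := B1; have : 1 <= z ^+ 2 by rewrite exprn_ege1.
nra.
Qed.

Variable e : R.
Hypothesis e_gt0 : 0 < e.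
Local Notation eta := (B%:R * l / (e * T%:R)).
Local Notation delta := (B%:R / y).

(** As [T] is the cube of [y], the left side is [l / (e * B * y)], and the right side is [B ^ 3]
    times that. *)
Lemma variance_le_rate : eta / delta ^+ 2 <= Th / e.
Proof.
have yT := cbrt_cube; have lp := ltW l0.
move: y0 yT lp; set z := y; set a := l => z0 zT a0.
have [eN BN zN] : [/\ e != 0, B%:R != 0 :> R & z != 0] by rewrite !gt_eqF.
rewrite -zT (_ : _ / (_ / z) ^+ 2 = a / (e * B%:R * z)); last by field; rewrite ?eN ?BN ?zN.
rewrite (_ : _ / z / e = a / (e * B%:R * z) * B%:R ^+ 3); last by field; rewrite ?eN ?BN ?zN.
rewrite ler_peMr ?exprn_ege1 // divr_ge0 // ltW // !mulr_gt0 //.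
Qed.

(** The power is at most [exp (- 2 * k * eta * e)] with [k] one less than the quotient of [T] by
    [B]. Since [T < (k + 2) * B <= 3 * k * B], the product [k * eta * e] is at least [l / 3], so the
    power is at most [(B / T)^(2/3)], hence at most [B / y]. *)
Lemma contraction_le_rate : 0 <= 1 - 2 * eta * e -> (1 - 2 * eta * e) ^+ (T %/ B).-1 <= 2 * Th.
Proof.
set q := 1 - _ => q0; set k := (T %/ B).-1.
apply: le_trans perturbation_le_rate.
have k1 : (0 < k)%N.
  by rewrite -ltnS prednK ?divn_gt0 // ?leq_divRL // (leq_trans _ BT) // leq_pmull.
have kB : (T <= 3 * k * B)%N.
  have h : (T < (T %/ B).+1 * B)%N by exact: ltn_ceil.
  apply: leq_trans (ltnW h) _; rewrite leq_mul2r; apply/orP; right.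
  by move: k1; rewrite /k; case: (T %/ B)%N => [|[|m]] //= _; lia.
have kBR : T%:R <= 3 * k%:R * B%:R :> R by rewrite -!natrM ler_nat.
have qe : q <= expR (- (2 * eta * e)) by have := @expR_ge1Dx R (- (2 * eta * e)); rewrite /q; lra.
apply: (@le_trans _ _ (expR (- (2 * eta * e)) ^+ k)).
  by rewrite lerXn2r // ?nnegrE ?expR_ge0.
rewrite -expRM_natl.
have eE : eta * e * T%:R = B%:R * l by field; rewrite !gt_eqF.
have ke : l <= 3 * (k%:R * (eta * e)).
  rewrite -(ler_pM2r T0) (_ : _ * _ * T%:R = 3 * k%:R * (eta * e * T%:R)); last by ring.
  rewrite eE mulrA [leLHS]mulrC ler_wpM2r // ltW //.
have lE : l = ln T%:R - ln B%:R by rewrite ln_div ?posrE.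
have lB : 0 <= ln B%:R :> R by rewrite ln_ge0.
have -> : B%:R / y = expR (ln B%:R - ln T%:R / 3).
  rewrite expRD lnK ?posrE //; congr (_ * _).
  by rewrite /powR gt_eqF // expRN div1r mulrC.
rewrite ler_expR.
have := l0; lra.
Qed.

End Rates.

Section Margin.
Context {R : realType} {N : nat}.
Variables (mu r : 'I_N -> R) (L : 'I_N -> 'I_N -> R).
Hypotheses (N_gt0 : (0 < N)%N) (r_gt0 : forall i, 0 < r i)
  (dom : forall i, \sum_(j < N | j != i) r j * L i j < r i * mu i).
Local Notation m i := (mu i - (r i)^-1 * \sum_(j < N | j != i) r j * L i j).

Let m_gt0 i : 0 < m i.
Proof. by rewrite subr_gt0 -ltr_pdivlMl ?invr_gt0 // invrK. Qed.

Lemma margin_min : exists i, dominance_margin mu r L = m i /\ forall j, m i <= m j.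
Proof.
pose i0 := Ordinal N_gt0.
pose i := [arg min_(i < i0) m i]%O.
have mi j : m i <= m j by rewrite /i; case: Order.TotalTheory.arg_minP => // k _; apply.
exists i; split=> //; apply/eqP; rewrite eq_le; apply/andP; split.
  apply: ge_inf; last by exists i.
  by exists (m i) => _ [j _ <-].
by apply: lb_le_inf; [exists (m i), i | move=> _ [j _ <-]].
Qed.

Lemma margin_gt0 : 0 < dominance_margin mu r L.
Proof. by have [i [-> _]] := margin_min. Qed.

Lemma margin_le i : dominance_margin mu r L <= m i.
Proof. by have [j [-> ]] := margin_min. Qed.

End Margin.

(** * Convergence *)

(** After division by [r i ^+ 2] the AM-GM weights turn each cross term into [r j / r i * L i j]
    times the mean of two normalized distances. So the new value is at most [(1 - 2 * eta * mu i +
    eta * s) * bi + eta * s * S] plus the error, hence at most [(1 - 2 * eta * e) * (W + V)] plus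
    the error, which the missing [2 * eta * e * W] absorbs. *)
Lemma scaled_update {R : realFieldType} {N : nat} (mu r a : 'I_N -> R) (L : 'I_N -> 'I_N -> R)
    (i : 'I_N) (eta e W V err st a' : R) :
  (forall j, 0 < r j) -> (forall j, 0 <= L i j) -> 0 <= eta -> 2 * eta * mu i <= 1 ->
  e <= mu i - (r i)^-1 * \sum_(j < N | j != i) r j * L i j ->
  0 <= W + V -> (forall j, a j / r j ^+ 2 <= W + V) ->
  2 * eta * err + st <= 2 * eta * e * W * r i ^+ 2 ->
  a' <= a i - 2 * eta * (mu i * a i
     - \sum_(j < N | j != i) L i j * ((r j / r i * a i + r i / r j * a j) / 2) - err) + st ->
  a' / r i ^+ 2 <= W + (1 - 2 * eta * e) * V.
Proof.
move=> r0 L0 eta0 etamu em S0 aS hst ha.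
set s := (r i)^-1 * _ in em; set S := W + V in S0 aS.
have ri2 : 0 < r i ^+ 2 by rewrite exprn_gt0.
rewrite ler_pdivrMr //; set bi := a i / r i ^+ 2.
have ai : a i = r i ^+ 2 * bi by rewrite /bi mulrC divfK // gt_eqF.
have s0 : 0 <= s.
  by rewrite /s mulr_ge0 ?invr_ge0 ?(ltW (r0 i)) // sumr_ge0 // => j _; rewrite mulr_ge0 // ltW.
have hsum : \sum_(j < N | j != i) L i j * ((r j / r i * a i + r i / r j * a j) / 2)
    <= r i ^+ 2 * (s * ((bi + S) / 2)).
  rewrite /s mulr_sumr mulr_suml mulr_sumr; apply: ler_sum => j _.
  have rj2 : 0 < r j ^+ 2 by rewrite exprn_gt0.
  have aj : a j = r j ^+ 2 * (a j / r j ^+ 2) by rewrite mulrC divfK // gt_eqF.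
  have ri_n0 : r i != 0 by rewrite gt_eqF.
  have rj_n0 : r j != 0 by rewrite gt_eqF.
  set bj := a j / r j ^+ 2 in aj; have hj : bj <= S := aS j.
  rewrite (_ : L i j * _ = r i * r j * L i j / 2 * (bi + bj)); last first.
    by rewrite ai aj; field; rewrite ?ri_n0 ?rj_n0.
  rewrite (_ : r i ^+ 2 * _ = r i * r j * L i j / 2 * (bi + S)); last first.
    by field; rewrite ?ri_n0.
  by rewrite ler_wpM2l ?lerD2l // divr_ge0 // !mulr_ge0 // ltW.
have h1 : 2 * eta * \sum_(j < N | j != i) L i j * ((r j / r i * a i + r i / r j * a j) / 2)
   <= 2 * eta * (r i ^+ 2 * (s * ((bi + S) / 2))) by rewrite ler_wpM2l // mulr_ge0.
(* Replacing [bi] by the larger [S] needs a nonnegative coefficient, which is what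
   [2 * eta * mu i <= 1] provides. *)
have h2 : (1 - 2 * eta * mu i + eta * s) * bi <= (1 - 2 * eta * mu i + eta * s) * S.
  by rewrite ler_wpM2l ?aS // addr_ge0 ?subr_ge0 // mulr_ge0.
have h3 : eta * (s - mu i) * S <= eta * (- e) * S.
  by rewrite ler_wpM2r // ler_wpM2l //; lra.
have h4 := ler_wpM2l (ltW ri2) h2; have h5 := ler_wpM2l (ltW ri2) h3.
apply: le_trans ha _; rewrite ai in h1 *; rewrite /S in h1 h4 h5 *; lra.
Qed.

Theorem theorem2 (R : realType) (N d : nat) (rho D U Uc : R)
    (mu r : 'I_N -> R) (L : 'I_N -> 'I_N -> R) :
  (0 < N)%N -> (0 < d)%N -> 0 < rho -> 0 < D ->
  (forall i, 0 < mu i) -> (forall i, 0 < r i) ->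
  (forall i, \sum_(j < N | j != i) r j * L i j < r i * mu i) ->
  exists2 c : R, 0 < c &
  forall (X : 'I_N -> set 'rV[R]_d) (C : 'I_N -> 'M[R]_(N, d) -> R),
  (* the game *)
  (forall i, closed (X i)) ->
  (forall i, convex_set (X i)) ->
  (forall i v, enorm v <= rho -> X i v) ->
  (forall i v w, X i v -> X i w -> enorm (v - w) <= D) ->
  (forall i, measurable_fun (profiles X : set (borel_mx R N d)) (C i)) ->
  (forall i x, profiles X x -> differentiable_own X C i x) ->
  (* quasidominance *)
  (forall i x, profiles X x -> strongly_convex (mu i) (X i) (own_cost C i x)) ->
  (forall i j x y, profiles X x -> profiles X y ->
     (forall k, k != j -> row k x = row k y) ->
     enorm (own_gradient X C i x - own_gradient X C i y)
       <= L i j * enorm (row j x - row j y)) ->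
  (* bounded gradients and costs *)
  (forall i x, profiles X x -> enorm (own_gradient X C i x) <= U) ->
  (forall i x, profiles X x -> `|C i x| <= Uc) ->
  forall xs : 'M[R]_(N, d), is_nash X C xs ->
  forall B T : nat, (1 <= B)%N -> (2 * B <= T)%N ->
  let delta := B%:R / T%:R `^ (1 / 3) in
  let eta := B%:R * ln (T%:R / B%:R) / (dominance_margin mu r L * T%:R) in
  delta < rho ->
  forall Tup : 'I_N -> set nat,
  (forall i, Tup i `<=` [set t | (1 <= t)%N]) ->
  (* partial asynchronism *)
  (forall i t, (1 <= t)%N -> exists2 s, Tup i s & (t <= s < t + B)%N) ->
  forall x1 xh0 : 'M[R]_(N, d),
  (forall i, shrink (X i) rho delta (row i x1)) -> profiles X xh0 ->
  forall (dO : measure_display) (Om : measurableType dO) (P : probability Om R)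
    (u : 'I_N -> nat -> Om -> 'rV[R]_d),
  (forall i t, Tup i t -> uniform_on_sphere P (u i t)) ->
  mutually_independent P [set k : 'I_N * nat | Tup k.1 k.2]
    (fun k => u k.1 k.2 : Om -> borel_mx R 1 d) ->
  forall x xh : Om -> nat -> 'M[R]_(N, d),
  (forall w, zo_run X C rho eta delta Tup x1 xh0 (fun i t => u i t w) (x w) (xh w)) ->
  (\big[maxe/-oo]_(i < N) 'E_P[fun w => (enorm (row i (x w T) - row i xs) ^+ 2)%R]
    <= (c * (B%:R ^+ 2 * ln (T%:R / B%:R) / T%:R `^ (1 / 3)))%:E)%E.
Proof.
move=> N_gt0 d_gt0 rho_gt0 D_gt0 mu_gt0 r_gt0 dom.
set e := dominance_margin mu r L.
have e_gt0 : 0 < e by exact: margin_gt0.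
(* The constant is fixed before the game is given, when the signs of [L], [U] and [Uc] are still
   unknown, hence the absolute values. Sums over the agents serve as bounds uniform in the agent. *)
pose Lam := \sum_i \sum_j `|L i j|.
pose S := \sum_i (r i ^+ 2)^-1.
pose Q := \sum_i r i ^+ 2.
pose M := \sum_i mu i.
(* [A] bounds the coefficient of [delta] in the error of an update. In units of the rate [Th], [E0]
   bounds that error, [F0] bounds [step ^+ 2 / eta], and [W0] is the level at which the contraction
   pays for both. In [c1] the factors 2 and 4 come from splitting the squared distance at the
   target; [c2] serves for large [eta]. *)
pose A := (2 * d%:R + d%:R ^+ 2) * Lam * D + `|U| * (1 / rho * D)
  + Lam * (1 / rho * D) * D + Lam * (1 + 1 / rho * D) * D.
pose E0 := 2 * A + rho / e * (d%:R * `|Uc|) * Lam * D.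
pose F0 := (d%:R * `|Uc|) ^+ 2 / e.
pose W0 := S * (E0 + F0) / e.
pose c1 := 2 * (Q * (W0 + 2 * (D ^+ 2 * S))) + 4 * (D ^+ 2 / rho).
pose c2 := 2 * M * D ^+ 2 / e.
have Lam0 : 0 <= Lam by apply: sumr_ge0 => i _; apply: sumr_ge0.
have S0 : 0 <= S by apply: sumr_ge0 => i _; rewrite invr_ge0 sqr_ge0.
have Q0 : 0 <= Q by apply: sumr_ge0 => i _; rewrite sqr_ge0.
have M0 : 0 <= M by apply: sumr_ge0 => i _; exact: ltW.
have D0 := ltW D_gt0.
have rD0 : 0 <= 1 / rho * D by rewrite mulr_ge0 // divr_ge0 // ltW.
have riV : 0 <= rho^-1 by rewrite invr_ge0 ltW.
have eV : 0 <= e^-1 by rewrite invr_ge0 ltW.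
have A0 : 0 <= A by do ?[apply: addr_ge0 | apply: mulr_ge0 | apply: exprn_ge0].
have E00 : 0 <= E0 by do ?[apply: addr_ge0 | apply: mulr_ge0 | apply: exprn_ge0] => //; exact: ltW.
have F00 : 0 <= F0 by do ?[apply: addr_ge0 | apply: mulr_ge0 | apply: exprn_ge0].
have W00 : 0 <= W0 by rewrite /W0 !mulr_ge0 // addr_ge0.
have c10 : 0 <= c1.
  by rewrite addr_ge0 // !mulr_ge0 // ?addr_ge0 // ?mulr_ge0 // ?sqr_ge0 // invr_ge0 ltW.
have c20 : 0 <= c2 by rewrite divr_ge0 ?mulr_ge0 ?sqr_ge0 // ltW.
exists (c1 + c2 + 1); first by rewrite ltr_wpDl // addr_ge0.
move=> X C X_closed X_convex X_ball X_diam C_meas C_diff C_sc C_lip C_grad C_bound xs xs_nash.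
move=> B T B_gt0 BT delta eta delta_lt Tup Tup_gt0 Tup_async x1 xh0 x1P xh0P dO Om P u
  u_unif u_ind x xh run.
set Th := B%:R ^+ 2 * ln (T%:R / B%:R) / T%:R `^ (1 / 3).
have Th0 : 0 < Th := rate_gt0 B_gt0 BT.
have B0 : 0 < B%:R :> R by rewrite ltr0n.
have T_gt0 : (0 < T)%N by rewrite (leq_trans _ BT) // muln_gt0.
have T0 : 0 < T%:R :> R by rewrite ltr0n.
have l0 : 0 < ln (T%:R / B%:R) :> R by have := log_ratio_ge (R := R) B_gt0 BT; lra.
have delta_gt0 : 0 < delta by rewrite divr_gt0 // powR_gt0.
have eta_gt0 : 0 < eta by rewrite divr_gt0 // mulr_gt0.
have eta_ge0 := ltW eta_gt0.
have deltaTh : delta <= 2 * Th := perturbation_le_rate B_gt0 BT.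
have varTh : eta / delta ^+ 2 <= Th / e := variance_le_rate B_gt0 BT e_gt0.
have L0 i j : 0 <= L i j := lipschitz_ge0 d_gt0 rho_gt0 X_ball C_lip i j.
have xX w i t : (1 <= t)%N -> X i (row i (x w t)).
  exact: (run_in rho_gt0 X_closed X_ball Tup_gt0 x1P (run w)).
pose a i t := msd rho delta xs P x i t.
have bsq i : bdd_meas (fun w => enorm (row i (x w T) - row i xs) ^+ 2).
  exact: (sqdist_bdd rho_gt0 D_gt0 delta_gt0 delta_lt X_closed X_convex X_ball X_diam C_meas
    xs_nash Tup_gt0 x1P xh0P u_unif run i (row i xs) T_gt0).
apply/bigmax_leP; split=> [|i _]; first exact: leNye.
rewrite Ex_expectation ?lee_fin; last exact: bsq.
(* For large [eta] the diameter suffices: [D ^+ 2 <= 2 * eta * M * D ^+ 2], and [eta] is at most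
   [Th / e]. Otherwise [2 * eta * mu j <= 1] for every agent. *)
have [big|small] := leP 1 (2 * eta * M).
  apply: (@le_trans _ _ (D ^+ 2)).
    rewrite -[leRHS](Ex_cst P); apply: Ex_le => //; first exact: bdd_meas_cst.
    move=> w; rewrite ler_pXn2r ?nnegrE ?enorm_ge0 //.
    by apply: X_diam; [exact: xX | exact: xs_nash.1].
  apply: (@le_trans _ _ (c2 * Th)); last by rewrite ler_wpM2r ?ltW //; lra.
  apply: (@le_trans _ _ (2 * eta * M * D ^+ 2)); first by rewrite ler_peMl ?sqr_ge0.
  have := log_step_le_rate (R := R) B_gt0 BT; rewrite -/Th => h.
  rewrite (_ : 2 * eta * M * D ^+ 2 = c2 * (B%:R * ln (T%:R / B%:R) / T%:R)).
    by rewrite ler_wpM2l.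
  by rewrite /c2 /eta -/e; field; rewrite !gt_eqF.
have le_sum (f : 'I_N -> R) j : (forall k, 0 <= f k) -> f j <= \sum_k f k.
  by move=> f0; rewrite (bigD1 j) //= lerDl sumr_ge0.
have etamu j : 2 * eta * mu j <= 1.
  have muM : mu j <= M by exact: (le_sum mu j (fun k => ltW (mu_gt0 k))).
  by apply: le_trans (ltW small); rewrite ler_wpM2l // mulr_ge0.
have row_le j : \sum_k L j k <= Lam.
  apply: le_trans (le_sum (fun j => \sum_k `|L j k|) j _) => [|k]; last exact: sumr_ge0.
  by apply: ler_sum => k _; exact: ler_norm.
have diag_le j : L j j <= Lam by apply: le_trans (row_le j); exact: (le_sum (L j)).
have off_le j : \sum_(k < N | k != j) L j k <= Lam.
  by apply: le_trans (row_le j); rewrite [leRHS](bigD1 j) //= lerDr.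
have off_ge0 j : 0 <= \sum_(k < N | k != j) L j k by exact: sumr_ge0.
pose step := step_bound (n := d) Uc eta delta.
have dN : delta != 0 by rewrite gt_eqF.
have dUc : 0 <= d%:R * `|Uc| by rewrite mulr_ge0.
have step_le : step <= Th * (rho / e * (d%:R * `|Uc|)).
  rewrite (_ : step = (eta / delta ^+ 2) * delta * (d%:R * Uc)); last first.
    by rewrite /step /step_bound; field; rewrite ?dN.
  have h1 : eta / delta ^+ 2 * delta <= Th / e * rho.
    by apply: ler_pM => //; [rewrite divr_ge0 ?sqr_ge0 | exact: ltW | exact: ltW].
  apply: (@le_trans _ _ (eta / delta ^+ 2 * delta * (d%:R * `|Uc|))).
    rewrite ler_wpM2l ?ler_wpM2l ?ler_norm //.
    by rewrite mulr_ge0 ?(ltW delta_gt0) // divr_ge0 // sqr_ge0.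
  apply: le_trans (ler_wpM2r dUc h1) _.
  by rewrite le_eqVlt; apply/orP; left; apply/eqP; ring.
(* One factor [eta] is kept outside, because the square is weighed against [2 * eta * e * W]. *)
have step_sq : step ^+ 2 <= eta * (Th * F0).
  rewrite (_ : step ^+ 2 = eta * (eta / delta ^+ 2 * (d%:R * Uc) ^+ 2)); last first.
    by rewrite /step /step_bound; field; rewrite ?dN.
  rewrite ler_wpM2l // (_ : Th * F0 = Th / e * (d%:R * `|Uc|) ^+ 2); last by rewrite /F0; ring.
  have -> : (d%:R * `|Uc|) ^+ 2 = (d%:R * Uc) ^+ 2.
    by rewrite !exprMn real_normK ?num_real.
  by rewrite ler_wpM2r ?sqr_ge0.
pose err j := drift_error (n := d) rho D U delta L (delta + step) j
  + d%:R * (1 + d%:R) * L j j * delta * D.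
have err_le j : err j <= Th * E0.
  have -> : err j = delta * ((2 * d%:R + d%:R ^+ 2) * L j j * D + U * (1 / rho * D)
      + L j j * (1 / rho * D) * D + (\sum_(k < N | k != j) L j k) * (1 + 1 / rho * D) * D)
      + (\sum_(k < N | k != j) L j k) * step * D.
    rewrite /err /drift_error -mulr_suml.
    by field; rewrite gt_eqF.
  apply: (@le_trans _ _ (delta * A + Lam * (Th * (rho / e * (d%:R * `|Uc|))) * D)); last first.
    have h := ler_wpM2r A0 deltaTh.
    rewrite (_ : Th * E0 = 2 * Th * A + Lam * (Th * (rho / e * (d%:R * `|Uc|))) * D).
      by rewrite lerD2r.
    by rewrite /E0; ring.
  have st0 : 0 <= Th * (rho / e * (d%:R * `|Uc|)).
    by rewrite !mulr_ge0 // ltW.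
  apply: lerD.
    rewrite (ler_pM2l delta_gt0) /A; apply: lerD; [apply: lerD; [apply: lerD|]|].
    - by rewrite ler_wpM2r // ler_wpM2l.
    - by rewrite ler_wpM2r // ler_norm.
    - by rewrite ler_wpM2r // ler_wpM2r // diag_le.
    - rewrite ler_wpM2r // ler_wpM2r ?off_le //.
      by rewrite addr_ge0.
  rewrite ler_wpM2r //; apply: (@le_trans _ _
    ((\sum_(k < N | k != j) L j k) * (Th * (rho / e * (d%:R * `|Uc|))))).
    by rewrite ler_wpM2l.
  by rewrite ler_wpM2r.
pose W := Th * W0.
have W_ge0 : 0 <= W by rewrite mulr_ge0 // ltW.
have r2_gt0 j : 0 < r j ^+ 2 by rewrite exprn_gt0.
have S_le j : (r j ^+ 2)^-1 <= S.
  by apply: (le_sum (fun j => (r j ^+ 2)^-1)) => k; rewrite invr_ge0 sqr_ge0.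
have total_err j : 2 * eta * err j + step ^+ 2 <= 2 * eta * e * W * r j ^+ 2.
  have Sr : 1 <= S * r j ^+ 2 by rewrite -ler_pdivrMr // div1r.
  have h1 := ler_wpM2l (mulr_ge0 (ler0n R 2) eta_ge0) (err_le j).
  have EF : 0 <= 2 * eta * Th * (E0 + F0).
    apply: mulr_ge0; last exact: addr_ge0.
    by apply: mulr_ge0; [exact: mulr_ge0 | exact: ltW].
  have h2 := ler_wpM2l EF Sr.
  have eN : e != 0 by rewrite gt_eqF.
  have -> : 2 * eta * e * W * r j ^+ 2 = 2 * eta * Th * (E0 + F0) * (S * r j ^+ 2).
    by rewrite /W /W0; field.
  have h3 : 0 <= eta * (Th * F0).
    by apply: mulr_ge0 => //; apply: mulr_ge0 => //; exact: ltW.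
  by apply: le_trans (lerD h1 step_sq) _; lra.
pose q := 1 - 2 * eta * e.
have q_ge0 : 0 <= q.
  rewrite subr_ge0; apply: le_trans (etamu i); apply: ler_wpM2l.
    exact: mulr_ge0.
  have /le_trans -> // : e <= _ := margin_le mu r L N_gt0 i.
  rewrite gerBl mulr_ge0 ?invr_ge0 ?(ltW (r_gt0 i)) // sumr_ge0 // => j _.
  by rewrite mulr_ge0 // ltW.
have Z0 : 0 <= D ^+ 2 * S by rewrite mulr_ge0 // sqr_ge0.
(* One of the windows is spent waiting until every agent has updated, hence the predecessor. *)
have kB : (B + (T %/ B).-1 * B <= T)%N.
  by rewrite -mulSn prednK ?leq_trunc_div // divn_gt0 // (leq_trans _ BT) // leq_pmull.
have := @window_contraction R N (fun j t => a j t / r j ^+ 2) Tup B q W (D ^+ 2 * S)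
  B_gt0 q_ge0 Z0 Tup_async _ _ _ (T %/ B).-1 i T kB.
have a_le j t : (1 <= t)%N -> a j t <= D ^+ 2.
  exact: (msd_le rho_gt0 D_gt0 delta_gt0 delta_lt X_closed X_convex X_ball X_diam C_meas
    xs_nash Tup_gt0 x1P xh0P u_unif run).
have h_idle j t : (B <= t)%N -> ~ Tup j t -> a j t.+1 / r j ^+ 2 = a j t / r j ^+ 2.
  by move=> Bt jt; rewrite /a (msd_idle _ _ run) // (leq_trans B_gt0).
have h_update j t V : (B <= t)%N -> Tup j t -> 0 <= V ->
    (forall k, a k t / r k ^+ 2 <= W + V) -> a j t.+1 / r j ^+ 2 <= W + q * V.
  move=> Bt jt V0 aV.
  have h := msd_update d_gt0 rho_gt0 D_gt0 delta_gt0 delta_lt eta_ge0 mu_gt0 r_gt0 X_closed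
    X_convex X_ball X_diam C_meas C_diff C_sc C_lip C_grad C_bound xs_nash Tup_async Tup_gt0
    x1P xh0P u_unif u_ind run jt Bt.
  apply: (scaled_update (a := fun k => a k t) (err := err j) (st := step ^+ 2) r_gt0 _ eta_ge0
    (etamu j) (margin_le mu r L N_gt0 j) _ aV (total_err j)) => [k||].
  - exact: L0.
  - exact: addr_ge0.
  apply: le_trans h _; rewrite /err -/step /a; lra.
have h_bound j t : (B <= t)%N -> a j t / r j ^+ 2 <= W + D ^+ 2 * S.
  move=> Bt; apply: (@le_trans _ _ (D ^+ 2 * S)); last by rewrite lerDr.
  rewrite ler_pM ?invr_ge0 ?sqr_ge0 ?S_le ?a_le ?(leq_trans B_gt0) //.
  by apply: Rintegral_ge0 => w _; rewrite sqr_ge0.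
move=> /(_ h_idle h_update h_bound) /= h.
have q_le : q ^+ (T %/ B).-1 <= 2 * Th := contraction_le_rate B_gt0 BT e_gt0 q_ge0.
have a_T : a i T <= Q * (Th * W0 + 2 * Th * (D ^+ 2 * S)).
  rewrite ler_pdivrMr // mulrC in h; apply: le_trans h _; apply: ler_pM => //.
  - exact: ltW.
  - by rewrite addr_ge0 // mulr_ge0 // exprn_ge0.
  - by apply: (le_sum (fun j => r j ^+ 2)) => k; rewrite sqr_ge0.
  - by rewrite lerD2l ler_wpM2r.
have dr_le1 : delta / rho <= 1 by rewrite ler_pdivrMr // mul1r ltW.
have dr_ge0 : 0 <= delta / rho by rewrite divr_ge0 // ltW.
(* The square of [delta / rho] is bounded by its first power, which is all that the rate
   requires. *)
have target_sq : enorm (target rho delta xs i - row i xs) ^+ 2 <= 2 * Th * (D ^+ 2 / rho).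
  have h1 := target_dist rho_gt0 delta_gt0 X_ball X_diam xs_nash i.
  apply: (@le_trans _ _ ((delta / rho * D) ^+ 2)).
    by rewrite ler_pXn2r ?nnegrE ?enorm_ge0 // mulr_ge0.
  apply: (@le_trans _ _ (delta / rho * D ^+ 2)).
    by rewrite exprMn ler_wpM2r ?sqr_ge0 // expr2 ler_piMr.
  rewrite mulrAC -mulrA ler_wpM2r ?deltaTh // divr_ge0 ?sqr_ge0 // ltW //.
set v := enorm (target rho delta xs i - row i xs) ^+ 2 in target_sq.
have split_sq w : enorm (row i (x w T) - row i xs) ^+ 2
    <= 2 * enorm (row i (x w T) - target rho delta xs i) ^+ 2 + 2 * v.
  have h1 := enorm_triangle (target rho delta xs i) (row i (x w T)) (row i xs).
  apply: (@le_trans _ _ ((enorm (row i (x w T) - target rho delta xs i)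
    + enorm (target rho delta xs i - row i xs)) ^+ 2)).
    by rewrite ler_pXn2r ?nnegrE ?addr_ge0 ?enorm_ge0.
  rewrite /v -subr_ge0 (_ : _ - _ = (enorm (row i (x w T) - target rho delta xs i)
    - enorm (target rho delta xs i - row i xs)) ^+ 2); last by ring.
  exact: sqr_ge0.
have bmsd : bdd_meas (fun w => enorm (row i (x w T) - target rho delta xs i) ^+ 2).
  exact: (sqdist_bdd rho_gt0 D_gt0 delta_gt0 delta_lt X_closed X_convex X_ball X_diam C_meas
    xs_nash Tup_gt0 x1P xh0P u_unif run i (target rho delta xs i) T_gt0).
have := Ex_le P (bsq i) (bdd_measD (bdd_measZ 2 bmsd) (bdd_meas_cst (2 * v))) split_sq.
rewrite ExD; [|exact: bdd_measZ|exact: bdd_meas_cst].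
rewrite ExZ // Ex_cst -/(msd rho delta xs P x i T) -/(a i T) => h2.
apply: le_trans h2 _.
have c2Th : 0 <= (c2 + 1) * Th by rewrite mulr_ge0 ?addr_ge0 // ltW.
rewrite /c1; lra.
Qed.
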